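(* \textsc{Edge-Colorable Subgraph (ECS)} admits a problem kernel with $\mathcal{O}(c^3\cdot\lambda_c)$ vertices: there is a polynomial-time algorithm that, given an instance $(G,c,k)$ of \textsc{ECS}, outputs an equivalent instance of \textsc{ECS} whose graph has $\mathcal{O}(c^3\cdot\lambda_c)$ vertices, where $\lambda_c$ is the component order connectivity of $G$.
   Context: All graphs are simple and undirected. A $c$-colored labeling of $G=(V,E)$ is a partition $L=(S^1_L,\dots,S^c_L,W_L)$ of $E$ into strong color classes $S^i_L$ and weak edges $W_L$; it is proper if no two distinct edges sharing an endpoint lie in the same $S^i_L$. \textsc{ECS}: given a graph $G$ and integers $c,k\in\mathbb{N}$, decide whether $G$ has a proper $c$-colored labeling $L$ with $|W_L|\le k$. A set $D\subseteq V$ is an order-$c$ component cover if every connected component of $G-D$ has at most $c$ vertices; $\lambda_c$ is the minimum size of an order-$c$ component cover of $G$. *)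

(* Defs.v *)
From Corelib Require Import BinNums.
From mathcomp Require Import all_boot.

Set Implicit Arguments.
Unset Strict Implicit.
Unset Printing Implicit Defensive.

(** * Graphs, colored labelings, component order connectivity *)

(* As graphs are inputs of algorithms, the vertex set is {0, ..., nverts - 1}. *)
Record graph := Graph {
  nverts : nat;
  adj : rel 'I_nverts;
  adj_sym : symmetric adj;
  adj_irr : irreflexive adj
}.

Definition vertex (G : graph) : finType := 'I_(nverts G).

Definition edges (G : graph) : {set {set vertex G}} :=
  [set A | [exists x, exists y, adj x y && (A == [set x; y])]].

(* Classes of the partition may be empty, so [finset.partition] does not apply:
   the parts are an indexed family [S] and a further set [W]. *)
Definition colored_labeling (G : graph) (c : nat)
    (S : 'I_c -> {set {set vertex G}}) (W : {set {set vertex G}}) : Prop :=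
  [/\ forall i j, i != j -> [disjoint S i & S j],
      forall i, [disjoint S i & W]
    & (\bigcup_i S i) :|: W = edges G].

Definition proper_labeling (G : graph) (c : nat)
    (S : 'I_c -> {set {set vertex G}}) : Prop :=
  forall (A B : {set vertex G}), A \in edges G -> B \in edges G ->
    A != B -> A :&: B != set0 -> forall i, ~~ ((A \in S i) && (B \in S i)).

Definition adj_minus (G : graph) (D : {set vertex G}) : rel (vertex G) :=
  [rel x y | [&& x \notin D, y \notin D & adj x y]].

Definition components_minus (G : graph) (D : {set vertex G}) :
    {set {set vertex G}} :=
  equivalence_partition (connect (adj_minus D)) (~: D).

Definition component_cover (G : graph) (c : nat) (D : {set vertex G}) : bool :=
  [forall K in components_minus D, #|K| <= c].

(* The default value [setT] always is an order-c component cover, see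
   [component_cover_setT], so this is a genuine minimum. *)
Definition comp_order_conn (G : graph) (c : nat) : nat :=
  #|[arg min_(D < [set: vertex G] | component_cover c D) #|D| ]|.

Lemma component_cover_setT (G : graph) (c : nat) :
  component_cover c [set: vertex G].
Proof.
apply/forall_inP => K /imsetP [x].
by rewrite setCT inE.
Qed.

(** * The problem ECS *)

Record ecs_instance := ECSInstance {
  ecs_graph : graph;
  ecs_colors : nat;
  ecs_budget : nat
}.

Definition ECS (I : ecs_instance) : Prop :=
  exists (S : 'I_(ecs_colors I) -> {set {set vertex (ecs_graph I)}})
         (W : {set {set vertex (ecs_graph I)}}),
    [/\ colored_labeling S W, proper_labeling S & #|W| <= ecs_budget I].

(** * Machine model: the language WHILE over binary trees

   This is the language of N. Jones, "Computability and Complexity from a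
   Programming Perspective", with its unit-cost time measure.  A tree is stored
   as a pointer, and there is no test for equality of trees, so every unit-cost
   step is a constant number of pointer operations; up to a polynomial, time is
   the same as on Turing machines. *)

Inductive tree := Leaf | Node of tree & tree.

Definition tree_hd (t : tree) : tree := if t is Node a _ then a else Leaf.
Definition tree_tl (t : tree) : tree := if t is Node _ b then b else Leaf.
Definition tree_true (t : tree) : bool := if t is Node _ _ then true else false.

Fixpoint tree_size (t : tree) : nat :=
  if t is Node a b then (tree_size a + tree_size b).+1 else 1.

Inductive expr :=
  | EVar of nat
  | ELeaf
  | ENode of expr & expr
  | EHd of expr
  | ETl of expr.

Inductive cmd :=
  | Assign of nat & expr
  | Seq of cmd & cmd
  | If of expr & cmd & cmd
  | While of expr & cmd.

Definition store := nat -> tree.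

Definition update (s : store) (x : nat) (t : tree) : store :=
  fun y => if y == x then t else s y.

Fixpoint eval (s : store) (e : expr) : tree :=
  match e with
  | EVar x => s x
  | ELeaf => Leaf
  | ENode e1 e2 => Node (eval s e1) (eval s e2)
  | EHd e1 => tree_hd (eval s e1)
  | ETl e1 => tree_tl (eval s e1)
  end.

Fixpoint expr_time (e : expr) : nat :=
  match e with
  | EVar _ => 1
  | ELeaf => 1
  | ENode e1 e2 => (expr_time e1 + expr_time e2).+1
  | EHd e1 => (expr_time e1).+1
  | ETl e1 => (expr_time e1).+1
  end.

(* [exec p s t s']: started in [s], [p] halts in [s'] after exactly [t] steps. *)
Inductive exec : cmd -> store -> nat -> store -> Prop :=
  | ExecAssign s x e :
      exec (Assign x e) s (expr_time e).+1 (update s x (eval s e))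
  | ExecSeq p q s1 s2 s3 t1 t2 :
      exec p s1 t1 s2 -> exec q s2 t2 s3 -> exec (Seq p q) s1 (t1 + t2) s3
  | ExecIfTrue e p q s s' t :
      tree_true (eval s e) -> exec p s t s' ->
      exec (If e p q) s (expr_time e + t).+1 s'
  | ExecIfFalse e p q s s' t :
      ~~ tree_true (eval s e) -> exec q s t s' ->
      exec (If e p q) s (expr_time e + t).+1 s'
  | ExecWhileFalse e p s :
      ~~ tree_true (eval s e) -> exec (While e p) s (expr_time e).+1 s
  | ExecWhileTrue e p s1 s2 s3 t1 t2 :
      tree_true (eval s1 e) -> exec p s1 t1 s2 -> exec (While e p) s2 t2 s3 ->
      exec (While e p) s1 (expr_time e + t1 + t2).+1 s3.

Definition input_store (t : tree) : store := update (fun=> Leaf) 0 t.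

(** * Encoding of instances and polynomial-time computability *)

Definition enc_bool (b : bool) : tree := if b then Node Leaf Leaf else Leaf.

Definition enc_seq (s : seq tree) : tree := foldr Node Leaf s.

Fixpoint pos_bits (p : positive) : seq bool :=
  match p with
  | xH => [:: true]
  | xO p' => false :: pos_bits p'
  | xI p' => true :: pos_bits p'
  end.

(* Numbers are written in binary, least significant bit first. *)
Definition enc_nat (n : nat) : tree :=
  enc_seq [seq enc_bool b | b <- if bin_of_nat n is Npos p then pos_bits p
                                 else [::]].

(* The adjacency matrix, row by row; its number of rows gives [nverts]. *)
Definition enc_graph (G : graph) : tree :=
  enc_seq [seq enc_seq [seq enc_bool (adj x y) | y <- enum (vertex G)]
          | x <- enum (vertex G)].

Definition enc_instance (I : ecs_instance) : tree :=
  Node (enc_graph (ecs_graph I))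
       (Node (enc_nat (ecs_colors I)) (enc_nat (ecs_budget I))).

(* The output size is bounded separately: because of sharing, a program can
   build a tree of size exponential in its running time. *)
Definition polytime_computable (f : ecs_instance -> ecs_instance) : Prop :=
  exists (p : cmd) (a d : nat), forall I : ecs_instance,
    let bound := a * tree_size (enc_instance I) ^ d + a in
    exists (t : nat) (s : store),
      [/\ exec p (input_store (enc_instance I)) t s,
          s 0 = enc_instance (f I),
          t <= bound
        & tree_size (s 0) <= bound].

(* Main.v *)
(** Grow blobs greedily until they are connected components or have c + 1
    vertices. The blobs with c + 1 vertices are connected and disjoint, so every
    order-c component cover meets each of them, and the set D of their vertices
    has size at most (c + 1) lambda_c; the other, small, blobs are the components
    of G - D.

    Suppose that a family of small blobs has all its neighbours in a subset H of
    D, and that every v in H is adjacent to c private blobs of the family. Then H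
    and the family can be deleted: colouring the c private edges of v with all c colours, and
    everything inside the blobs by (i + j + shift) mod c, is optimal, because v
    has at most c strong edges anyway. The budget drops by e(H) - c |H|, where
    e(H) is the number of edges meeting H.

    Such an H is found by an auction. Every vertex of D offers c slots, and an
    unassigned small blob takes over the cheapest adjacent slot, raising its price
    by one and evicting its occupant. An occupant of a slot of price p then has no
    adjacent slot of price below p - 1. If N is the number of slots, some price l
    in {0, ..., N} is taken by no slot; the slots of price above l form a closed
    part, from which H is read off. What is kept is D - H and the at most c |D|
    occupants of slots of price below l. *)

From HB Require Import structures.
From Corelib Require Import BinNums.
Require Import Defs.
From mathcomp Require Import all_boot zify.

Set Implicit Arguments.
Unset Strict Implicit.
Unset Printing Implicit Defensive.

(** * Polynomially bounded functions *)

(** A set [H] with [c] private blobs for each of its vertices is what a crown decomposition or an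
    expansion lemma provides, usually by maximum matchings. The auction replaces augmenting paths by
    one loop of local updates whose state grows by a bounded amount per round; for loops of this
    shape, polynomial time on the WHILE machine is easy to certify.

    The cubic bound arises as follows: each of the [c |D|] slots keeps at most one blob of at most
    [c] vertices, so at most [(1 + c^2) |D|] vertices are kept, and [|D|] is at most
    [(c + 1) lambda_c].

    The number of colours is written in binary and may be exponential in the input size, whereas the
    algorithm computes with unary numbers. It therefore works with the minimum of [c] and the number
    of vertices. A blob with more vertices than this minimum can exist only if the minimum is [c]
    itself; otherwise [D] is empty and all blobs are deleted. *)

Definition polybound (P : nat -> nat) : Prop :=
  {homo P : m n / m <= n} /\ exists a, forall n, P n <= (n + a) ^ a.

Lemma leq_exp m n a b : 0 < n -> m <= n -> a <= b -> m ^ a <= n ^ b.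
Proof.
move=> n0 le_mn le_ab; apply: (@leq_trans (n ^ a)); last by rewrite leq_pexp2l.
by case: a {le_ab} => // a; rewrite leq_exp2r.
Qed.

Lemma polybound_const c : polybound (fun=> c).
Proof.
split=> //; exists c.+1 => n; rewrite expnS.
by apply: leq_trans (leq_pmulr _ _); rewrite ?expn_gt0; lia.
Qed.

Lemma polybound_id : polybound id.
Proof. by split=> //; exists 1 => n; rewrite expn1 leq_addr. Qed.

Lemma polybound_add P Q :
  polybound P -> polybound Q -> polybound (fun n => P n + Q n).
Proof.
move=> [mP [a aP]] [mQ [b bQ]]; split=> [m n le_mn|].
  by rewrite leq_add ?mP ?mQ.
exists (a + b).+2 => n; set x := n + (a + b).+2.
have le1 : P n <= x ^ (a + b).
  by apply: leq_trans (aP n) _; apply: leq_exp; rewrite /x; lia.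
have le2 : Q n <= x ^ (a + b).
  by apply: leq_trans (bQ n) _; apply: leq_exp; rewrite /x; lia.
apply: (@leq_trans (x ^ (a + b).+1)); last by apply: leq_exp; rewrite /x; lia.
rewrite expnS; move: (x ^ (a + b)) le1 le2 => y; rewrite /x; nia.
Qed.

Lemma polybound_mul P Q :
  polybound P -> polybound Q -> polybound (fun n => P n * Q n).
Proof.
move=> [mP [a aP]] [mQ [b bQ]]; split=> [m n le_mn|].
  by rewrite leq_mul ?mP ?mQ.
exists (a + b).+2 => n; set x := n + (a + b).+2.
apply: (@leq_trans (x ^ (a + b))); last by apply: leq_exp; rewrite /x; lia.
rewrite expnD; apply: leq_mul.
  by apply: leq_trans (aP n) _; apply: leq_exp; rewrite /x; lia.
by apply: leq_trans (bQ n) _; apply: leq_exp; rewrite /x; lia.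
Qed.

Lemma polybound_comp P Q :
  polybound P -> polybound Q -> polybound (fun n => P (Q n)).
Proof.
move=> [mP [a aP]] [mQ [b bQ]]; split=> [m n le_mn|].
  by rewrite mP ?mQ.
exists (b.+2 * a + a + b).+2 => n; set x := n + _.
have le1 : Q n <= x ^ b.+1.
  by apply: leq_trans (bQ n) _; apply: leq_exp; rewrite /x; lia.
have le2 : a <= x ^ b.+1.
  apply: (@leq_trans (x ^ 1)); first by rewrite /x; lia.
  by apply: leq_exp; rewrite /x; lia.
(* Both summands of [Q n + a] are at most [x ^ b.+1], and [x] is at least 2, so one more factor [x]
   absorbs the sum. *)
apply: leq_trans (aP _) _; apply: (@leq_trans ((x ^ b.+2) ^ a)).
  apply: leq_exp => //; first by rewrite expn_gt0 /x; lia.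
  rewrite (expnS _ b.+1); move: (x ^ b.+1) le1 le2 => y; rewrite /x; nia.
by rewrite -expnM; apply: leq_exp; rewrite /x; lia.
Qed.

Lemma polybound_monomial P :
  polybound P -> exists a d, forall n, 0 < n -> P n <= a * n ^ d + a.
Proof.
move=> [_ [a aP]]; exists (a.+1 ^ a), a => n n0.
apply: leq_trans (aP n) _; rewrite -expnMn; apply: leq_trans (leq_addr _ _).
by apply: leq_exp => //; nia.
Qed.

Ltac polybound_tac := repeat first
  [ assumption | exact: polybound_const | exact: polybound_id
  | apply: polybound_add | apply: polybound_mul
  | apply: polybound_comp ].

(** * Polynomial-time functions on encodable types *)

Class encodable (T : Type) := encode : T -> tree.

#[export] Instance encodable_unit : encodable unit := fun=> Leaf.
#[export] Instance encodable_bool : encodable bool := enc_bool.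
#[export] Instance encodable_seq T (e : encodable T) : encodable (seq T) :=
  fun s => enc_seq (map e s).
#[export] Instance encodable_prod S T (eS : encodable S) (eT : encodable T) :
  encodable (S * T) := fun x => Node (eS x.1) (eT x.2).
(* Unary, in contrast to [enc_nat]: used for quantities at most polynomial in
   the input size. *)
#[export] Instance encodable_nat : encodable nat :=
  fun n => enc_seq (nseq n Leaf).

(* Locked, as otherwise a pair and a nonempty list have unifiable sizes. *)
HB.lock Definition tsz T {e : encodable T} (x : T) := tree_size (encode x).
Arguments tsz {T e} x.

Lemma tree_size_gt0 t : 0 < tree_size t. Proof. by case: t. Qed.

Section Sizes.

Context {S T : Type} {eS : encodable S} {eT : encodable T}.

Lemma tsz_pair (x : S) (y : T) : tsz (x, y) = (tsz x + tsz y).+1.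
Proof. by rewrite tsz.unlock. Qed.

Lemma tsz_cons (x : T) s : tsz (x :: s) = (tsz x + tsz s).+1.
Proof. by rewrite tsz.unlock. Qed.

Lemma tsz_nil : tsz ([::] : seq T) = 1. Proof. by rewrite tsz.unlock. Qed.

Lemma tsz_cat (s1 s2 : seq T) : (tsz (s1 ++ s2)).+1 = tsz s1 + tsz s2.
Proof.
elim: s1 => [|x s1 IH]; first by rewrite tsz_nil add1n.
by rewrite cat_cons !tsz_cons; lia.
Qed.

Lemma size_tsz (s : seq T) : size s < tsz s.
Proof. elim: s => [|x s IH]; rewrite ?tsz_nil ?tsz_cons //=; lia. Qed.

Lemma tsz_rev (s : seq T) : tsz (rev s) = tsz s.
Proof.
elim: s => // x s IH; rewrite rev_cons -cats1.
by have := tsz_cat (rev s) [:: x]; rewrite !tsz_cons tsz_nil; lia.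
Qed.

End Sizes.

Lemma tsz_nat (n : nat) : tsz n = n.*2.+1.
Proof.
rewrite tsz.unlock; elim: n => // n.
by rewrite /encode /encodable_nat /=; lia.
Qed.

Lemma tsz_bool (b : bool) : tsz b <= 3. Proof. by rewrite tsz.unlock; case: b. Qed.

(* Variable 0 holds argument and result, variable 1 a stack that is left
   unchanged; all other variables are unused. *)
Definition polytime S T {eS : encodable S} {eT : encodable T} (f : S -> T) :=
  exists p P, polybound P /\ forall x s, s 0 = encode x ->
    exists t s', [/\ exec p s t s', s' 0 = encode (f x), s' 1 = s 1,
                     t <= P (tsz x) & tsz (f x) <= P (tsz x)].

(** * Basic programs: composition, pairing, branching, loops *)

Section Combinators.

Context {S T U V : Type} {eS : encodable S} {eT : encodable T}
  {eU : encodable U} {eV : encodable V}.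

Lemma eq_polytime (f g : S -> T) : f =1 g -> polytime f -> polytime g.
Proof.
move=> fg [p [P [Pb H]]]; exists p, P; split=> // x s /H.
by rewrite fg.
Qed.

Lemma polytime_size (f : S -> T) : polytime f ->
  exists2 P, polybound P & forall x, tsz (f x) <= P (tsz x).
Proof.
move=> [p [P [Pb H]]]; exists P => // x.
by have [t [s [//]]] := H x (fun=> encode x) erefl.
Qed.

Lemma polytime_expr (f : S -> T) e P : polybound P ->
  (forall x s, s 0 = encode x -> eval s e = encode (f x)) ->
  (forall x, tsz (f x) <= P (tsz x)) -> polytime f.
Proof.
move=> Pb He Hs; exists (Assign 0 e), (fun n => P n + (expr_time e).+1).
split=> [|x s s0]; first by polybound_tac.
exists (expr_time e).+1, (update s 0 (eval s e)); split=> //=.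
- exact: ExecAssign.
- by rewrite /update /= (He x).
- exact: leq_addl.
- by rewrite (leq_trans (Hs x)) ?leq_addr.
Qed.

Lemma polytime_encode (f : S -> T) :
  (forall x, encode (f x) = encode x) -> polytime f.
Proof.
move=> Hf; apply: (@polytime_expr f (EVar 0) id); first exact: polybound_id.
  by move=> x s s0; rewrite Hf.
by move=> x; rewrite tsz.unlock Hf.
Qed.

Lemma polytime_const (c : T) : polytime (fun _ : S => c).
Proof.
have build t : exists e, forall s, eval s e = t.
  elim: t => [|t1 [e1 H1] t2 [e2 H2]]; first by exists ELeaf.
  by exists (ENode e1 e2) => s /=; rewrite H1 H2.
have [e He] := build (encode c).
by apply: (@polytime_expr _ e (fun=> tsz c)) => //; exact: polybound_const.
Qed.

Lemma polytime_comp (f : S -> T) (g : T -> U) :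
  polytime f -> polytime g -> polytime (fun x => g (f x)).
Proof.
move=> [p [P [Pb Hp]]] [q [Q [Qb Hq]]].
exists (Seq p q), (fun n => P n + Q (P n)); split=> [|x s s0].
  by polybound_tac.
have [t1 [s1 [e1 o1 k1 le1 sz1]]] := Hp x s s0.
have [t2 [s2 [e2 o2 k2 le2 sz2]]] := Hq _ _ o1.
(* Only an upper bound on the size of [f x] is known, so evaluating [Q] there relies on the
   monotonicity built into [polybound]. *)
have mQ := Qb.1 _ _ sz1.
exists (t1 + t2), s2; split=> //; first exact: ExecSeq e1 e2.
- by rewrite k2.
- by rewrite leq_add // (leq_trans le2).
- by rewrite (leq_trans sz2) // (leq_trans mQ) ?leq_addl.
Qed.

(** A program may overwrite everything except the stack. So [x] is pushed before [p] runs, and is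
    replaced on the stack by [f x] before [q] runs on [x]. *)
Lemma polytime_pair (f : S -> T) (g : S -> U) :
  polytime f -> polytime g -> polytime (fun x => (f x, g x)).
Proof.
move=> [p [P [Pb Hp]]] [q [Q [Qb Hq]]].
exists (Seq (Assign 1 (ENode (EVar 0) (EVar 1))) (Seq p
   (Seq (Assign 1 (ENode (EVar 0) (EVar 1)))
   (Seq (Assign 0 (EHd (ETl (EVar 1))))
   (Seq (Assign 1 (ENode (EHd (EVar 1)) (ETl (ETl (EVar 1)))))
   (Seq q (Seq (Assign 0 (ENode (EHd (EVar 1)) (EVar 0)))
   (Assign 1 (ETl (EVar 1)))))))))), (fun n => P n + Q n + 100).
split=> [|x s s0]; first by polybound_tac.
set s1 := update s 1 (eval s (ENode (EVar 0) (EVar 1))).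
have [t1 [s2 [e1 o1 k1 le1 sz1]]] := Hp x s1 s0.
set s3 := update s2 1 (eval s2 (ENode (EVar 0) (EVar 1))).
set s4 := update s3 0 (eval s3 (EHd (ETl (EVar 1)))).
set s5 := update s4 1 (eval s4 (ENode (EHd (EVar 1)) (ETl (ETl (EVar 1))))).
have s50 : s5 0 = encode x by rewrite /s5 /s4 /s3 /update /= k1.
have [t2 [s6 [e2 o2 k2 le2 sz2]]] := Hq x s5 s50.
eexists _, _; split.
- apply: ExecSeq; first exact: ExecAssign.
  apply: ExecSeq; first exact: e1.
  apply: ExecSeq; first exact: ExecAssign.
  apply: ExecSeq; first exact: ExecAssign.
  apply: ExecSeq; first exact: ExecAssign.
  apply: ExecSeq; first exact: e2.
  apply: ExecSeq; first exact: ExecAssign.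
  exact: ExecAssign.
- by rewrite /update /= k2 o2 /s5 /s4 /s3 /update /= o1.
- by rewrite /update /= k2 /s5 /s4 /s3 /update /= k1.
- by rewrite /=; lia.
- by rewrite tsz_pair; lia.
Qed.

End Combinators.

Ltac time_lia := cbv beta in *; simpl expr_time in *; lia.

Section Data.

Context {S T U V : Type} {eS : encodable S} {eT : encodable T}
  {eU : encodable U} {eV : encodable V}.

Lemma polytime_id : polytime (@id S).
Proof. exact: polytime_encode. Qed.

Lemma polytime_fst (f : S -> T * U) : polytime f -> polytime (fun x => (f x).1).
Proof.
move=> Hf; apply: (polytime_comp (g := fst) Hf).
apply: (polytime_expr (e := EHd (EVar 0)) polybound_id); last first.
  by case=> x y; rewrite tsz_pair /=; lia.
by move=> x s s0 /=; rewrite s0.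
Qed.

Lemma polytime_snd (f : S -> T * U) : polytime f -> polytime (fun x => (f x).2).
Proof.
move=> Hf; apply: (polytime_comp (g := snd) Hf).
apply: (polytime_expr (e := ETl (EVar 0)) polybound_id); last first.
  by case=> x y; rewrite tsz_pair /=; lia.
by move=> x s s0 /=; rewrite s0.
Qed.

Lemma polytime_cons (f : S -> T) (g : S -> seq T) :
  polytime f -> polytime g -> polytime (fun x => f x :: g x).
Proof.
move=> Hf Hg.
apply: (polytime_comp (g := fun p => p.1 :: p.2) (polytime_pair Hf Hg)).
exact: polytime_encode.
Qed.

Lemma polytime_seq_of_nat (f : S -> nat) :
  polytime f -> polytime (fun x => nseq (f x) tt).
Proof.
move=> Hf; apply: (polytime_comp (g := fun n => nseq n tt) Hf).
by apply: polytime_encode => n; rewrite /encode /encodable_seq map_nseq.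
Qed.

Lemma polytime_if (b : S -> bool) (f g : S -> T) :
  polytime b -> polytime f -> polytime g ->
  polytime (fun x => if b x then f x else g x).
Proof.
move=> Hb [p [P [Pb Hp]]] [q [Q [Qb Hq]]].
apply: (polytime_comp (g := fun y => if y.1 then f y.2 else g y.2)
         (polytime_pair Hb polytime_id)).
exists (If (EHd (EVar 0)) (Seq (Assign 0 (ETl (EVar 0))) p)
          (Seq (Assign 0 (ETl (EVar 0))) q)), (fun n => P n + Q n + 10).
split=> [|[c x] s s0]; first by polybound_tac.
set s1 := update s 0 (eval s (ETl (EVar 0))).
have s10 : s1 0 = encode x by rewrite /s1 /update /= s0.
have mP : P (tsz x) <= P (tsz (c, x)).
  by apply: Pb.1; rewrite tsz_pair; lia.
have mQ : Q (tsz x) <= Q (tsz (c, x)).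
  by apply: Qb.1; rewrite tsz_pair; lia.
case: c s0 mP mQ => s0 mP mQ.
  have [t [s2 [e1 o1 k1 le1 sz1]]] := Hp x s1 s10.
  eexists _, _; split.
  - apply: ExecIfTrue; first by rewrite /= s0.
    by apply: ExecSeq; [exact: ExecAssign | exact: e1].
  - by [].
  - by [].
  - by time_lia.
  - by apply: leq_trans sz1 _; time_lia.
have [t [s2 [e1 o1 k1 le1 sz1]]] := Hq x s1 s10.
eexists _, _; split.
- apply: ExecIfFalse; first by rewrite /= s0.
  by apply: ExecSeq; [exact: ExecAssign | exact: e1].
- by [].
- by [].
- by time_lia.
- by apply: leq_trans sz1 _; time_lia.
Qed.

Lemma polytime_match (l : S -> seq U) (f : S -> T) (g : S -> U -> seq U -> T) :
  polytime l -> polytime f -> polytime (fun y => g y.1 y.2.1 y.2.2) ->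
  polytime (fun x => if l x is a :: r then g x a r else f x).
Proof.
move=> Hl [p [P [Pb Hp]]] [q [Q [Qb Hq]]].
apply: (polytime_comp
         (g := fun y => if y.1 is a :: r then g y.2 a r else f y.2)
         (polytime_pair Hl polytime_id)).
(* A nonempty list has the same encoding as the pair of its head and its tail, so swapping the two
   components already yields the encoding of [(x, (a, r))]. *)
exists (If (EHd (EVar 0))
          (Seq (Assign 0 (ENode (ETl (EVar 0)) (EHd (EVar 0)))) q)
          (Seq (Assign 0 (ETl (EVar 0))) p)), (fun n => P n + Q n + 20).
split=> [|[c x] s s0]; first by polybound_tac.
have mP : P (tsz x) <= P (tsz (c, x)).
  by apply: Pb.1; rewrite tsz_pair; lia.
have mQ a r : c = a :: r -> Q (tsz (x, (a, r))) <= Q (tsz (c, x)).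
  by move=> ->; apply: Qb.1; rewrite !tsz_pair tsz_cons; lia.
case: c s0 mP mQ => [|a r] s0 mP mQ.
  set s1 := update s 0 (eval s (ETl (EVar 0))).
  have s10 : s1 0 = encode x by rewrite /s1 /update /= s0.
  have [t [s2 [e1 o1 k1 le1 sz1]]] := Hp x s1 s10.
  eexists _, _; split.
  - apply: ExecIfFalse; first by rewrite /= s0.
    by apply: ExecSeq; [exact: ExecAssign | exact: e1].
  - by [].
  - by [].
  - by time_lia.
  - by apply: leq_trans sz1 _; time_lia.
set s1 := update s 0 (eval s (ENode (ETl (EVar 0)) (EHd (EVar 0)))).
have s10 : s1 0 = encode (x, (a, r)) by rewrite /s1 /update /= s0.
have [t [s2 [e1 o1 k1 le1 sz1]]] := Hq (x, (a, r)) s1 s10.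
have {}mQ := mQ _ _ erefl.
eexists _, _; split.
- apply: ExecIfTrue; first by rewrite /= s0.
  by apply: ExecSeq; [exact: ExecAssign | exact: e1].
- by [].
- by [].
- by time_lia.
- by apply: leq_trans sz1 _; time_lia.
Qed.

(** The accumulator must be bounded after every prefix, because a polynomial-time step may double
    its argument and its iterates then grow exponentially. The remaining list and [x] live in a
    frame on the stack, the only place that survives a run of [p]. *)
Lemma polytime_foldl (h : S -> T -> U -> T) (z : S -> T) (l : S -> seq U) P :
  polytime (fun y => h y.1 y.2.1 y.2.2) -> polytime z -> polytime l ->
  polybound P ->
  (forall x l1 l2, l x = l1 ++ l2 -> tsz (foldl (h x) (z x) l1) <= P (tsz x)) ->
  polytime (fun x => foldl (h x) (z x) (l x)).
Proof.
move=> [p [Q [Qb Hp]]] [pz [Pz [Pzb Hz]]] [pl [Pl [Plb Hl]]] Pb Hsz.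
have Hpre : polytime (fun x => (x, (z x, l x))).
  by apply: polytime_pair polytime_id (polytime_pair _ _);
    [exists pz, Pz | exists pl, Pl].
case: Hpre => [pi [Pi [Pib Hi]]].
pose step := Seq (Assign 0 (ENode (ETl (EHd (EVar 1)))
                                  (ENode (EVar 0) (EHd (EHd (EHd (EVar 1)))))))
   (Seq (Assign 1 (ENode (ENode (ETl (EHd (EHd (EVar 1)))) (ETl (EHd (EVar 1))))
                         (ETl (EVar 1)))) p).
pose loop := While (EHd (EHd (EVar 1))) step.
(* Time of one round, as long as the accumulator has size at most [B] and the remaining list size at
   most [L]. *)
pose body B L x := Q (@tsz S eS x + B + L + 2) + 100.
have loopP x rest B L : forall (r : seq U) acc s, s 0 = encode acc ->
    s 1 = Node (Node (encode r) (encode x)) rest ->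
    (forall l1 l2, r = l1 ++ l2 -> tsz (foldl (h x) acc l1) <= B) ->
    tsz r <= L ->
    exists t s', [/\ exec loop s t s', s' 0 = encode (foldl (h x) acc r),
      s' 1 = Node (Node Leaf (encode x)) rest & t <= size r * body B L x + 10].
  elim=> [|a r IH] acc s s0 s1 HB HL.
    exists 4, s; split=> //.
    by apply: (@ExecWhileFalse (EHd (EHd (EVar 1)))); rewrite /= s1.
  set u1 := update s 0 (eval s (ENode (ETl (EHd (EVar 1)))
                           (ENode (EVar 0) (EHd (EHd (EHd (EVar 1))))))).
  set u2 := update u1 1 (eval u1 (ENode (ENode (ETl (EHd (EHd (EVar 1))))
              (ETl (EHd (EVar 1)))) (ETl (EVar 1)))).
  have u20 : u2 0 = encode (x, (acc, a)) by rewrite /u2 /u1 /update /= s0 s1.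
  have [t [s2 [e1 o1 k1 le1 sz1]]] := Hp _ _ u20.
  have s21 : s2 1 = Node (Node (encode r) (encode x)) rest.
    by rewrite k1 /u2 /u1 /update /= s1.
  have [||t' [s' [e2 o2 k2 le2]]] := IH (h x acc a) s2 o1 s21.
    by move=> l1 l2 Er; apply: (HB (a :: l1) l2); rewrite Er.
    by move: HL; rewrite tsz_cons; lia.
  eexists _, s'; split; [|exact: o2|exact: k2|].
    apply: (@ExecWhileTrue (EHd (EHd (EVar 1))) step _ _ _ _ _ _ _ e2).
      by rewrite /= s1.
    apply: ExecSeq; first exact: ExecAssign.
    by apply: ExecSeq; [exact: ExecAssign | exact: e1].
  have leQ : t <= Q (tsz x + B + L + 2).
    apply: leq_trans le1 (Qb.1 _ _ _); rewrite !tsz_pair.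
    have := HB [::] (a :: r) erefl; move: HL; rewrite tsz_cons /=; lia.
  have bodyE : body B L x = Q (tsz x + B + L + 2) + 100 by [].
  rewrite [size (a :: r)]/= mulSn bodyE in le2 *.
  by simpl expr_time; lia.
exists (Seq pi (Seq (Assign 1 (ENode (ENode (ETl (ETl (EVar 0)))
                                            (EHd (EVar 0))) (EVar 1)))
   (Seq (Assign 0 (EHd (ETl (EVar 0)))) (Seq loop
     (Assign 1 (ETl (EVar 1))))))).
exists (fun n => Pi n + P n + Pl n * (Q (n + P n + Pl n + 2) + 100) + 100).
split=> [|x s s0].
  apply: polybound_add; last exact: polybound_const.
  apply: polybound_add; first exact: polybound_add.
  apply: polybound_mul => //; apply: polybound_add; last exact: polybound_const.
  by apply: (polybound_comp Qb); polybound_tac.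
have [t1 [s1 [e1 o1 k1 le1 sz1]]] := Hi x s s0.
set u1 := update s1 1 (eval s1 (ENode (ENode (ETl (ETl (EVar 0)))
                                            (EHd (EVar 0))) (EVar 1))).
set u2 := update u1 0 (eval u1 (EHd (ETl (EVar 0)))).
have u20 : u2 0 = encode (z x) by rewrite /u2 /u1 /update /= o1.
have u21 : u2 1 = Node (Node (encode (l x)) (encode x)) (s 1).
  by rewrite /u2 /u1 /update /= o1 k1.
have leL : tsz (l x) <= Pl (tsz x).
  by have [? [? [//]]] := Hl x (fun=> encode x) erefl.
have [t2 [s2 [e2 o2 k2 le2]]] := loopP x (s 1) (P (tsz x)) (Pl (tsz x)) (l x)
  (z x) u2 u20 u21 (Hsz x) leL.
eexists _, _; split.
- apply: ExecSeq; first exact: e1.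
  apply: ExecSeq; first exact: ExecAssign.
  apply: ExecSeq; first exact: ExecAssign.
  by apply: ExecSeq; [exact: e2 | exact: ExecAssign].
- by rewrite /update /= o2.
- by rewrite /update /= k2.
- rewrite /=; apply: (@leq_trans (t1 + Pl (tsz x) *
      (Q (tsz x + P (tsz x) + Pl (tsz x) + 2) + 100) + 50)); last by lia.
  have : size (l x) * body (P (tsz x)) (Pl (tsz x)) x <=
         Pl (tsz x) * body (P (tsz x)) (Pl (tsz x)) x.
    by rewrite leq_mul //; have := @size_tsz _ eU (l x); lia.
  by rewrite /body in le2 *; lia.
- have := Hsz x (l x) [::]; rewrite cats0 => /(_ erefl); lia.
Qed.

End Data.

Ltac polytime_proj := repeat first
  [ assumption | exact: polytime_id | exact: polytime_const
  | apply: polytime_pair | apply: polytime_cons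
  | apply: polytime_fst | apply: polytime_snd ].

(** * Closure under folds, list functions, unary arithmetic, iteration *)

Section Folds.

Context {S T U : Type} {eS : encodable S} {eT : encodable T} {eU : encodable U}.

(** If the growth in each round does not depend on the accumulator, the growths merely add up, and
    their sum over the list stays polynomial. *)
Lemma polytime_foldl_add (h : S -> T -> U -> T) (z : S -> T) (l : S -> seq U) Q :
  polybound Q ->
  (forall x s a, tsz (h x s a) <= tsz s + Q (tsz x + tsz a)) ->
  polytime (fun y => h y.1 y.2.1 y.2.2) -> polytime z -> polytime l ->
  polytime (fun x => foldl (h x) (z x) (l x)).
Proof.
move=> Qb Hs Hh Hz Hl.
have [Pz Pzb szz] := polytime_size Hz; have [Pl Plb szl] := polytime_size Hl.
apply: (@polytime_foldl _ _ _ _ _ _ h z l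
          (fun n => Pz n + Pl n * Q (n + Pl n)) Hh Hz Hl).
  apply: polybound_add => //; apply: polybound_mul => //.
  by apply: (polybound_comp Qb); apply: polybound_add => //; exact: polybound_id.
move=> x l1 l2 El.
have {El} le1 : tsz l1 <= Pl (tsz x).
  by apply: leq_trans (szl x); rewrite El; have := @tsz_cat _ eU l1 l2;
    have := @size_tsz _ eU l2; lia.
apply: (@leq_trans (tsz (z x) + size l1 * Q (tsz x + tsz l1))); last first.
  apply: leq_add => //; apply: leq_mul; first by have := @size_tsz _ eU l1; lia.
  by apply: Qb.1; rewrite leq_add2l.
elim: l1 (z x) {le1} => [|a l1 IH] acc //=; rewrite ?leq_addr //.
apply: leq_trans (IH _) _; rewrite tsz_cons mulSn.
have le1 : tsz (h x acc a) <= tsz acc + Q (tsz x + (tsz a + tsz l1).+1).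
  apply: leq_trans (Hs _ _ _) _; rewrite leq_add2l.
  by apply: Qb.1; lia.
have : size l1 * Q (tsz x + tsz l1) <= size l1 * Q (tsz x + (tsz a + tsz l1).+1).
  by apply: leq_mul => //; apply: Qb.1; lia.
lia.
Qed.

(** For accumulators whose size is controlled by an invariant, such as the iterated predecessors of
    a binary numeral, which never get longer. *)
Lemma polytime_foldl_inv (h : S -> T -> U -> T) (z : S -> T) (l : S -> seq U)
    (I : S -> T -> Prop) P :
  polybound P -> (forall x, I x (z x)) ->
  (forall x s a, I x s -> I x (h x s a)) ->
  (forall x s, I x s -> tsz s <= P (tsz x)) ->
  polytime (fun y => h y.1 y.2.1 y.2.2) -> polytime z -> polytime l ->
  polytime (fun x => foldl (h x) (z x) (l x)).
Proof.
move=> Pb Iz Ih Is Hh Hz Hl.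
apply: (@polytime_foldl _ _ _ _ _ _ h z l P Hh Hz Hl Pb) => x l1 _ _.
apply: Is; elim: l1 (z x) (Iz x) => //= a l1 IH acc Iacc.
exact/IH/Ih.
Qed.

End Folds.

Section Lists.

Context {S T U V : Type} {eS : encodable S} {eT : encodable T}
  {eU : encodable U} {eV : encodable V}.

Lemma polytime_foldr_add (h : S -> U -> T -> T) (z : S -> T) (l : S -> seq U) Q :
  polybound Q ->
  (forall x a s, tsz (h x a s) <= tsz s + Q (tsz x + tsz a)) ->
  polytime (fun y => h y.1 y.2.1 y.2.2) -> polytime z -> polytime l ->
  polytime (fun x => foldr (h x) (z x) (l x)).
Proof.
move=> Qb Hs Hh Hz Hl.
have Hrev : polytime (fun x => rev (l x)).
  apply: (eq_polytime (f := fun x => foldl (fun s a => a :: s) [::] (l x))).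
    move=> x; rewrite /rev; elim: (l x) [::] => //= a r IH s; exact: IH.
  apply: (polytime_foldl_add (h := fun _ s a => a :: s) (Q := fun n => n + 1)) => //.
  - exact: polybound_add polybound_id (polybound_const 1).
  - by move=> x s a; rewrite tsz_cons; lia.
  - by polytime_proj.
  - exact: polytime_const.
apply: (eq_polytime (f := fun x => foldl (fun s a => h x a s) (z x) (rev (l x)))).
  by move=> x; rewrite foldl_rev.
apply: (polytime_foldl_add Qb (fun x s a => Hs x a s)) => //.
apply: (polytime_comp (f := fun y : S * (T * U) => (y.1, (y.2.2, y.2.1)))
                      (g := fun y => h y.1 y.2.1 y.2.2)) => //.
by polytime_proj.
Qed.

End Lists.

Section Booleans.

Context {S U : Type} {eS : encodable S} {eU : encodable U}.

Lemma polytime_andb (a b : S -> bool) :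
  polytime a -> polytime b -> polytime (fun x => a x && b x).
Proof. by move=> Ha Hb; apply: (polytime_if Ha Hb (polytime_const false)). Qed.

Lemma polytime_orb (a b : S -> bool) :
  polytime a -> polytime b -> polytime (fun x => a x || b x).
Proof. by move=> Ha Hb; apply: (polytime_if Ha (polytime_const true) Hb). Qed.

Lemma polytime_negb (a : S -> bool) : polytime a -> polytime (fun x => ~~ a x).
Proof.
by move=> Ha; apply: (polytime_if Ha (polytime_const false) (polytime_const true)).
Qed.

Lemma polytime_nilp (l : S -> seq U) : polytime l -> polytime (fun x => nilp (l x)).
Proof.
move=> Hl.
apply: (eq_polytime (f := fun x => if l x is a :: r then false else true)).
  by move=> x; case: (l x).
by apply: (polytime_match (g := fun _ _ _ => false) Hl); exact: polytime_const.
Qed.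

Lemma polytime_succ (n : S -> nat) : polytime n -> polytime (fun x => (n x).+1).
Proof.
move=> Hn; apply: (polytime_comp (g := succn) Hn).
apply: (polytime_expr (e := ENode ELeaf (EVar 0)) (P := fun n => n + 2)).
- exact: polybound_add polybound_id (polybound_const 2).
- by move=> x s /= ->.
- by move=> x; rewrite !tsz_nat; lia.
Qed.

End Booleans.

Section ListFunctions.

Context {S U V : Type} {eS : encodable S} {eU : encodable U} {eV : encodable V}.

Lemma polytime_map (h : S -> U -> V) (l : S -> seq U) :
  polytime (fun y => h y.1 y.2) -> polytime l ->
  polytime (fun x => map (h x) (l x)).
Proof.
move=> Hh Hl; have [P Pb szh] := polytime_size Hh.
apply: (@polytime_foldr_add _ _ _ _ _ _ (fun x a s => h x a :: s)
          (fun _ => [::]) l (fun n => P (n + 1) + 1)) => //.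
- apply: polybound_add; last exact: polybound_const.
  exact: (polybound_comp Pb (polybound_add polybound_id (polybound_const 1))).
- move=> x a s; rewrite tsz_cons; have := szh (x, a).
  by rewrite tsz_pair !addn1 /=; lia.
- apply: polytime_cons; last by polytime_proj.
  apply: (polytime_comp (f := fun y : S * (U * seq V) => (y.1, y.2.1))
            (g := fun y => h y.1 y.2)) => //; by polytime_proj.
- by polytime_proj.
Qed.

Lemma polytime_filter (p : S -> U -> bool) (l : S -> seq U) :
  polytime (fun y => p y.1 y.2) -> polytime l ->
  polytime (fun x => filter (p x) (l x)).
Proof.
move=> Hp Hl.
apply: (eq_polytime
  (f := fun x => foldr (fun a s => if p x a then a :: s else s) [::] (l x))).
  by move=> x; elim: (l x) => //= a r ->.
apply: (@polytime_foldr_add _ _ _ _ _ _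
  (fun x a s => if p x a then a :: s else s) (fun _ => [::]) l (fun n => n + 1)) => //.
- exact: polybound_add polybound_id (polybound_const 1).
- by move=> x a s; case: ifP => _; rewrite ?tsz_cons; lia.
- apply: polytime_if; [|by polytime_proj|by polytime_proj].
  apply: (polytime_comp (f := fun y : S * (U * seq U) => (y.1, y.2.1))
            (g := fun y => p y.1 y.2)) => //; by polytime_proj.
- by polytime_proj.
Qed.

Lemma polytime_has (p : S -> U -> bool) (l : S -> seq U) :
  polytime (fun y => p y.1 y.2) -> polytime l ->
  polytime (fun x => has (p x) (l x)).
Proof.
move=> Hp Hl.
apply: (eq_polytime (f := fun x => ~~ nilp (filter (p x) (l x)))).
  by move=> x /=; elim: (l x) => //= a r IH; case: (p x a).
exact/polytime_negb/polytime_nilp/polytime_filter.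
Qed.

Lemma polytime_cat (l1 l2 : S -> seq U) :
  polytime l1 -> polytime l2 -> polytime (fun x => l1 x ++ l2 x).
Proof.
move=> H1 H2.
apply: (eq_polytime (f := fun x => foldr (fun a s => a :: s) (l2 x) (l1 x))).
  by move=> x; elim: (l1 x) => //= a r ->.
apply: (@polytime_foldr_add _ _ _ _ _ _
  (fun _ a s => a :: s) _ _ (fun n => n + 1)) => //.
- exact: polybound_add polybound_id (polybound_const 1).
- by move=> x a s; rewrite tsz_cons; lia.
- by polytime_proj.
Qed.

Lemma polytime_rev (l : S -> seq U) : polytime l -> polytime (fun x => rev (l x)).
Proof.
move=> Hl.
apply: (eq_polytime (f := fun x => foldl (fun s a => a :: s) [::] (l x))).
  by move=> x /=; rewrite /rev; elim: (l x) [::] => //= a r IH s; exact: IH.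
apply: (@polytime_foldl_add _ _ _ _ _ _
  (fun _ s a => a :: s) (fun=> [::]) _ (fun n => n + 1)) => //.
- exact: polybound_add polybound_id (polybound_const 1).
- by move=> x s a; rewrite tsz_cons; lia.
- by polytime_proj.
- exact: polytime_const.
Qed.

Lemma polytime_size_seq (l : S -> seq U) :
  polytime l -> polytime (fun x => size (l x)).
Proof.
move=> Hl.
apply: (@polytime_foldr_add _ _ _ _ _ _
  (fun _ _ n => n.+1) (fun=> 0) _ (fun=> 2)) => //.
- exact: polybound_const.
- by move=> x a s; rewrite !tsz_nat; lia.
- by apply: polytime_succ; polytime_proj.
- exact: polytime_const.
Qed.

Lemma polytime_find (p : S -> U -> bool) (l : S -> seq U) :
  polytime (fun y => p y.1 y.2) -> polytime l ->
  polytime (fun x => find (p x) (l x)).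
Proof.
move=> Hp Hl.
apply: (eq_polytime (f := fun x => foldr (fun a n => if p x a then 0 else n.+1)
                                          0 (l x))).
  by move=> x; elim: (l x) => //= a r ->.
apply: (@polytime_foldr_add _ _ _ _ _ _ (fun x a n => if p x a then 0 else n.+1)
  (fun=> 0) _ (fun n => 2)) => //.
- exact: polybound_const.
- by move=> x a s; case: ifP; rewrite !tsz_nat; lia.
- apply: polytime_if; last by apply: polytime_succ; polytime_proj.
    apply: (polytime_comp (f := fun y : S * (U * nat) => (y.1, y.2.1))
            (g := fun y => p y.1 y.2)) => //; by polytime_proj.
  exact: polytime_const.
- exact: polytime_const.
Qed.

Lemma polytime_behead (l : S -> seq U) :
  polytime l -> polytime (fun x => behead (l x)).
Proof.
move=> Hl.
apply: (eq_polytime (f := fun x => if l x is a :: r then r else [::])).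
  by move=> x; case: (l x).
by apply: (polytime_match (g := fun _ _ r => r) Hl); polytime_proj.
Qed.

Lemma polytime_head (d : S -> U) (l : S -> seq U) :
  polytime d -> polytime l -> polytime (fun x => head (d x) (l x)).
Proof.
move=> Hd Hl.
by apply: (polytime_match (g := fun _ a _ => a) Hl); polytime_proj.
Qed.

End ListFunctions.

Section Surgery.

Context {S U : Type} {eS : encodable S} {eU : encodable U}.

Lemma polytime_flatten (l : S -> seq (seq U)) :
  polytime l -> polytime (fun x => flatten (l x)).
Proof.
move=> Hl.
apply: (@polytime_foldr_add _ _ _ _ _ _ (fun _ a s => a ++ s) (fun=> [::]) _ id) => //.
- exact: polybound_id.
- by move=> x a s; have := @tsz_cat _ eU a s; lia.
- by apply: polytime_cat; polytime_proj.
- exact: polytime_const.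
Qed.

Lemma polytime_drop (n : S -> nat) (l : S -> seq U) :
  polytime n -> polytime l -> polytime (fun x => drop (n x) (l x)).
Proof.
move=> Hn Hl.
apply: (eq_polytime (f := fun x => foldl (fun s _ => behead s) (l x) (nseq (n x) tt))).
  move=> x; elim: (n x) (l x) => [|m IH] s /=; first by rewrite drop0.
  by rewrite IH -drop1 drop_drop addn1.
apply: (@polytime_foldl_add _ _ _ _ _ _ (fun _ s _ => behead s) _ _ (fun n => 0)) => //.
- exact: polybound_const.
- by move=> x [|a s] _; rewrite ?tsz_cons /=; lia.
- by apply: polytime_behead; polytime_proj.
- exact: polytime_seq_of_nat.
Qed.

Lemma polytime_nth (d : S -> U) (l : S -> seq U) (n : S -> nat) :
  polytime d -> polytime l -> polytime n ->
  polytime (fun x => nth (d x) (l x) (n x)).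
Proof.
move=> Hd Hl Hn.
apply: (eq_polytime (f := fun x => head (d x) (drop (n x) (l x)))).
  by move=> x /=; rewrite -nth0 nth_drop addn0.
exact: polytime_head (polytime_drop _ _).
Qed.

Lemma polytime_nseq (n : S -> nat) (a : S -> U) :
  polytime n -> polytime a -> polytime (fun x => nseq (n x) (a x)).
Proof.
move=> Hn Ha.
apply: (eq_polytime (f := fun x => map (fun _ => a x) (nseq (n x) tt))).
  by move=> x /=; rewrite map_nseq.
apply: (polytime_map (h := fun x _ => a x)); last exact: polytime_seq_of_nat.
by apply: (polytime_comp (g := a)); polytime_proj.
Qed.

Lemma polytime_eq0 (n : S -> nat) : polytime n -> polytime (fun x => n x == 0).
Proof.
move=> Hn; apply: (eq_polytime (f := fun x => nilp (nseq (n x) tt))).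
  by move=> x /=; rewrite /nilp size_nseq.
exact/polytime_nilp/polytime_seq_of_nat.
Qed.

Lemma polytime_addn (m n : S -> nat) :
  polytime m -> polytime n -> polytime (fun x => m x + n x).
Proof.
move=> Hm Hn.
apply: (eq_polytime (f := fun x => size (nseq (m x) tt ++ nseq (n x) tt))).
  by move=> x /=; rewrite size_cat !size_nseq.
by apply: polytime_size_seq; apply: polytime_cat; apply: polytime_seq_of_nat.
Qed.

End Surgery.

Section Comparisons.

Context {S U : Type} {eS : encodable S} {eU : encodable U}.

Lemma polytime_subn (m n : S -> nat) :
  polytime m -> polytime n -> polytime (fun x => m x - n x).
Proof.
move=> Hm Hn.
apply: (eq_polytime (f := fun x => size (drop (n x) (nseq (m x) tt)))).
  by move=> x /=; rewrite size_drop size_nseq.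
apply: polytime_size_seq; apply: polytime_drop => //.
exact: polytime_seq_of_nat.
Qed.

Lemma polytime_leq (m n : S -> nat) :
  polytime m -> polytime n -> polytime (fun x => m x <= n x).
Proof. by move=> Hm Hn; apply: polytime_eq0; apply: polytime_subn. Qed.

Lemma polytime_eqn (m n : S -> nat) :
  polytime m -> polytime n -> polytime (fun x => m x == n x).
Proof.
move=> Hm Hn; apply: (eq_polytime (f := fun x => (m x <= n x) && (n x <= m x))).
  by move=> x /=; rewrite eqn_leq.
by apply: polytime_andb; apply: polytime_leq.
Qed.

End Comparisons.

Section Products.

Context {S U : Type} {eS : encodable S} {eU : encodable U}.

Lemma polytime_mem (a : S -> nat) (l : S -> seq nat) :
  polytime a -> polytime l -> polytime (fun x => a x \in l x).
Proof.
move=> Ha Hl; apply: (eq_polytime (f := fun x => has (fun b => b == a x) (l x))).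
  by move=> x /=; rewrite has_pred1.
apply: (polytime_has (p := fun x b => b == a x)) => //.
apply: polytime_eqn; first by polytime_proj.
by apply: (polytime_comp (g := a)); polytime_proj.
Qed.

Lemma polytime_muln (m n : S -> nat) :
  polytime m -> polytime n -> polytime (fun x => m x * n x).
Proof.
move=> Hm Hn.
apply: (eq_polytime
         (f := fun x => size (flatten (nseq (m x) (nseq (n x) tt))))).
  move=> x /=; rewrite size_flatten /shape map_nseq size_nseq.
  by rewrite sumn_nseq mulnC.
apply: polytime_size_seq; apply: polytime_flatten; apply: polytime_nseq => //.
exact: polytime_seq_of_nat.
Qed.

Lemma polytime_take (n : S -> nat) (l : S -> seq U) :
  polytime n -> polytime l -> polytime (fun x => take (n x) (l x)).
Proof.
move=> Hn Hl.
apply: (eq_polytime (f := fun x => rev (drop (size (l x) - n x) (rev (l x))))).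
  by move=> x /=; rewrite -[in RHS](revK (l x)) take_rev size_rev.
apply: polytime_rev; apply: polytime_drop; last exact: polytime_rev.
by apply: polytime_subn => //; exact: polytime_size_seq.
Qed.

Lemma tsz_iota m n : tsz (iota m n) <= n * (m + n + 1).*2 + 1.
Proof.
elim: n m => [|n IH] m; first by rewrite tsz_nil.
by rewrite /= tsz_cons tsz_nat; have := IH m.+1; lia.
Qed.

Lemma polytime_iota0 (n : S -> nat) :
  polytime n -> polytime (fun x => iota 0 (n x)).
Proof.
move=> Hn; have [P Pb szn] := polytime_size Hn.
(* Pushing the current length onto the accumulator produces the numbers in decreasing order. *)
have E (l : seq unit) :
    foldl (fun s (_ : unit) => size s :: s) [::] l = rev (iota 0 (size l)).
  elim/last_ind: l => // l u IH.
  by rewrite foldl_rcons IH size_rcons -addn1 iotaD rev_cat /= size_rev size_iota.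
apply: (eq_polytime (f := fun x => rev (foldl (fun s _ => size s :: s) [::]
                                             (nseq (n x) tt)))).
  by move=> x /=; rewrite E revK size_nseq.
apply: polytime_rev.
apply: (@polytime_foldl _ _ _ _ _ _ (fun _ s _ => size s :: s) (fun=> [::]) _
  (fun k => P k * (P k + P k + 1 + 1) + 1)).
- by apply: polytime_cons; [apply: polytime_size_seq|]; polytime_proj.
- exact: polytime_const.
- exact: polytime_seq_of_nat.
- by polybound_tac.
- move=> x l1 l2 El; rewrite E tsz_rev; apply: leq_trans (tsz_iota _ _) _.
  have := szn x; rewrite tsz_nat.
  have : size (l1 ++ l2) = n x by rewrite -El size_nseq.
  by rewrite size_cat; nia.
Qed.

End Products.

Section Iter.

Context {S T : Type} {eS : encodable S} {eT : encodable T}.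

Lemma iter_foldl (n : nat) (h : T -> T) z :
  iter n h z = foldl (fun s (_ : unit) => h s) z (nseq n tt).
Proof. by elim: n z => //= n IH z; rewrite -IH -iterSr. Qed.

Lemma polytime_iter_add (h : S -> T -> T) (z : S -> T) (n : S -> nat) Q :
  polybound Q -> (forall x s, tsz (h x s) <= tsz s + Q (tsz x)) ->
  polytime (fun y => h y.1 y.2) -> polytime z -> polytime n ->
  polytime (fun x => iter (n x) (h x) (z x)).
Proof.
move=> Qb Hs Hh Hz Hn.
apply: (eq_polytime (f := fun x => foldl (fun s (_ : unit) => h x s) (z x)
                                         (nseq (n x) tt))).
  by move=> x; rewrite iter_foldl.
apply: (@polytime_foldl_add _ _ _ _ _ _ (fun x s _ => h x s) z _ Q) => //.
- by move=> x s a; apply: leq_trans (Hs x s) _; rewrite leq_add2l Qb.1 ?leq_addr.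
- apply: (polytime_comp (f := fun y : S * (T * unit) => (y.1, y.2.1))
                        (g := fun y => h y.1 y.2)) => //; by polytime_proj.
- exact: polytime_seq_of_nat.
Qed.

Lemma polytime_iter_inv (h : S -> T -> T) (z : S -> T) (n : S -> nat)
    (I : S -> T -> Prop) P :
  polybound P -> (forall x, I x (z x)) -> (forall x s, I x s -> I x (h x s)) ->
  (forall x s, I x s -> tsz s <= P (tsz x)) ->
  polytime (fun y => h y.1 y.2) -> polytime z -> polytime n ->
  polytime (fun x => iter (n x) (h x) (z x)).
Proof.
move=> Pb Iz Ih Is Hh Hz Hn.
apply: (eq_polytime (f := fun x => foldl (fun s (_ : unit) => h x s) (z x)
                                         (nseq (n x) tt))).
  by move=> x; rewrite iter_foldl.
apply: (@polytime_foldl_inv _ _ _ _ _ _ (fun x s _ => h x s) z _ I P) => //.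
- by move=> x s _; exact: Ih.
- apply: (polytime_comp (f := fun y : S * (T * unit) => (y.1, y.2.1))
                        (g := fun y => h y.1 y.2)) => //; by polytime_proj.
- exact: polytime_seq_of_nat.
Qed.

End Iter.

Ltac poly_step := cbv beta; first
  [ assumption | exact: polytime_id | exact: polytime_const
  | apply: polytime_pair | apply: polytime_fst | apply: polytime_snd
  | apply: polytime_andb | apply: polytime_orb | apply: polytime_negb
  | apply: polytime_match
  | apply: polytime_iota0 | apply: polytime_nth | apply: polytime_cons
  | apply: polytime_head
  | apply: polytime_behead
  | apply: polytime_map | apply: polytime_filter | apply: polytime_has
  | apply: polytime_find | apply: polytime_nilp
  | apply: polytime_flatten | apply: polytime_nseq
  | apply: polytime_take | apply: polytime_drop | apply: polytime_rev
  | apply: polytime_size_seq | apply: polytime_mem | apply: polytime_leq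
  | apply: polytime_eqn
  | apply: polytime_addn | apply: polytime_subn | apply: polytime_muln
  | apply: polytime_succ | apply: polytime_cat | apply: polytime_if ].

Ltac poly := repeat poly_step.

(** * Arithmetic on binary numerals *)

(** Binary predecessor, least significant bit first: the zeros below the lowest one become ones, and
    this one becomes zero. If it was the top bit it is dropped, so that the numeral stays canonical.
    Zero is mapped to itself. *)
Definition bpred (bs : seq bool) : seq bool :=
  let i := find id bs in
  let r := drop i.+1 bs in
  nseq i true ++ (if nilp r then [::] else false :: r).

Lemma polytime_bpred : polytime bpred.
Proof. rewrite /bpred; poly. Qed.

Lemma tsz_bits (bs : seq bool) : tsz bs <= 4 * size bs + 1.
Proof.
elim: bs => [|b bs IH]; first by rewrite tsz_nil.
by rewrite tsz_cons /=; have := tsz_bool b; lia.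
Qed.

Lemma size_bpred bs : size (bpred bs) <= size bs.
Proof.
rewrite /bpred size_cat size_nseq; have := find_size id bs.
case: ifP => [_|]; first by rewrite addn0.
rewrite /nilp size_drop /= size_drop; lia.
Qed.

Lemma polytime_iter_bpred S (eS : encodable S) (n : S -> nat) (b : S -> seq bool) :
  polytime n -> polytime b -> polytime (fun x => iter (n x) bpred (b x)).
Proof.
move=> Hn Hb; have [P Pb szb] := polytime_size Hb.
apply: (@polytime_iter_inv _ _ _ _ (fun _ => bpred) b n
  (fun x s => size s <= size (b x)) (fun n => 4 * P n + 1)) => //.
- by apply: polybound_add (polybound_mul _ _) _; polybound_tac.
- by move=> x s /(leq_trans (size_bpred s)).
- move=> x s les; apply: leq_trans (tsz_bits s) _; have := szb x.
  have : size (b x) < tsz (b x) by exact: size_tsz.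
  lia.
- by apply: (polytime_comp (g := bpred)); [poly | exact: polytime_bpred].
Qed.

(** The minimum of [n] and the value of [bs], in unary: it counts the [i < n] for which [i]
    predecessor steps do not reach zero. The value itself may be too large to be written in unary in
    polynomial time. *)
Definition cap (n : nat) (bs : seq bool) : nat :=
  size [seq i <- iota 0 n | ~~ nilp (iter i bpred bs)].

Lemma polytime_cap S (eS : encodable S) (n : S -> nat) (b : S -> seq bool) :
  polytime n -> polytime b -> polytime (fun x => cap (n x) (b x)).
Proof.
move=> Hn Hb; rewrite /cap.
apply: polytime_size_seq; apply: polytime_filter; last by poly.
apply: polytime_negb; apply: polytime_nilp; apply: polytime_iter_bpred; first by poly.
by apply: (polytime_comp (g := b)); poly.
Qed.

(** * The kernelization algorithm *)

Definition madj (M : seq (seq bool)) (x y : nat) : bool :=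
  nth false (nth [::] M x) y.

Definition unused (n : nat) (Bs : seq (seq nat)) : seq nat :=
  [seq y <- iota 0 n | y \notin flatten Bs].

(** Only the head of the list is still growing. For empty [Bs] the default head [[::]] has no
    neighbours, so the second branch opens the first blob. Each step uses up one vertex, hence the
    number of iterations in [blobs]. *)
Definition grow (M : seq (seq bool)) (c : nat) (Bs : seq (seq nat)) :=
  let A := head [::] Bs in
  let R := unused (size M) Bs in
  if (if size A <= c then [seq y <- R | has (madj M y) A] else [::]) is y :: _
  then (y :: A) :: behead Bs
  else if R is y :: _ then [:: y] :: Bs else Bs.

Definition blobs (M : seq (seq bool)) (c : nat) : seq (seq nat) :=
  iter (size M) (grow M c) [::].

Lemma polytime_blobs : polytime (fun x => blobs x.1 x.2).
Proof.
apply: (@polytime_iter_add _ _ _ _ (fun x => grow x.1 x.2) (fun=> [::])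
  (fun x => size x.1) (fun n => n * 2 + 5)).
- by apply: polybound_add (polybound_mul _ _) _; polybound_tac.
- move=> [M c] Bs /=; rewrite /grow.
  have bnd y r : unused (size M) Bs = y :: r -> tsz y <= tsz (M, c) * 2.
    move=> E; have : y \in unused (size M) Bs by rewrite E mem_head.
    rewrite mem_filter mem_iota tsz_pair tsz_nat.
    have : size M < tsz M by exact: size_tsz.
    lia.
  set A := head [::] Bs; case: ifP => _; last first.
    case E: (unused _ _) => [|y r]; first by lia.
    by have := bnd _ _ E; rewrite !tsz_cons tsz_nil; lia.
  case E: (filter _ _) => [|y r]; last first.
    have : y \in [seq y <- unused (size M) Bs | has (madj M y) A].
      by rewrite E mem_head.
    rewrite !mem_filter mem_iota => /and3P [_ _ ly].
    have : tsz y <= tsz (M, c) * 2.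
      rewrite tsz_pair tsz_nat; have : size M < tsz M by exact: size_tsz.
      by lia.
    rewrite /A; case: (Bs) => [|B r'] /=; rewrite !tsz_cons ?tsz_nil; lia.
  case E': (unused _ _) => [|y r]; first by lia.
  by have := bnd _ _ E'; rewrite !tsz_cons tsz_nil; lia.
- rewrite /grow; apply: polytime_match.
  + by poly.
  + by poly.
  + by poly.
- by poly.
- by poly.
Qed.

(* A slot is a triple of a vertex, a price, and its list of occupants, which
   has at most one element. *)
Notation slot := (nat * (nat * seq (seq nat)))%type.
Definition owner (s : slot) : nat := s.1.
Definition price (s : slot) : nat := s.2.1.
Definition occupants (s : slot) : seq (seq nat) := s.2.2.

Definition biddable (M : seq (seq bool)) (A : seq nat) (p : nat) (s : slot) :=
  (price s == p) && has (madj M (owner s)) A.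

(** A blob without adjacent slot of price below [N] leaves the queue for good. When [p < N] a slot
    is found, so the default slot is never returned by [nth]. *)
Definition bid (M : seq (seq bool)) (N : nat) (st : seq (seq nat) * seq slot) :=
  if st.1 is A :: Q then
    let p := find (fun p => has (biddable M A p) st.2) (iota 0 N) in
    if p < N then
      let i := find (biddable M A p) st.2 in
      let s := nth (0, (0, [::])) st.2 i in
      (occupants s ++ Q,
       take i st.2 ++ (owner s, (p.+1, [:: A])) :: drop i.+1 st.2)
    else (Q, st.2)
  else st.

Definition smalls (M : seq (seq bool)) (c : nat) : seq (seq nat) :=
  [seq B <- blobs M c | size B <= c].

Definition bigs (M : seq (seq bool)) (c : nat) : seq nat :=
  flatten [seq B <- blobs M c | c < size B].

Definition slots0 (M : seq (seq bool)) (c : nat) : seq slot :=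
  flatten [seq nseq c (v, (0, [::])) | v <- bigs M c].

(** The number of rounds is the initial value of [auction_measure]: the length of the queue plus [N]
    possible price rises for each of the [N] slots. *)
Definition auction (M : seq (seq bool)) (c : nat) : seq slot :=
  let N := size (slots0 M c) in
  (iter (size (smalls M c) + N * N) (bid M N) (smalls M c, slots0 M c)).2.

Definition gap (S : seq slot) : nat :=
  find (fun p => ~~ has (fun s => price s == p) S) (iota 0 (size S).+1).

Definition low (S : seq slot) : seq slot := [seq s <- S | price s < gap S].

(** A single low slot suffices to keep a vertex. A heavy vertex thus has all its slots above the
    gap, and they supply its [c] private blobs. For [c = 0] there are no slots and every big vertex
    is heavy. *)
Definition heavy (M : seq (seq bool)) (c : nat) : seq nat :=
  [seq v <- bigs M c | v \notin map owner (low (auction M c))].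

Definition kept (M : seq (seq bool)) (c : nat) : seq nat :=
  [seq v <- bigs M c | v \in map owner (low (auction M c))] ++
  flatten (flatten (map occupants (low (auction M c)))).

Definition edge_count (M : seq (seq bool)) (H : seq nat) : nat :=
  size (flatten [seq [seq y <- iota 0 (size M) |
     [&& x < y, madj M x y & (x \in H) || (y \in H)]] | x <- iota 0 (size M)]).

Definition weak_count (M : seq (seq bool)) (c : nat) : nat :=
  edge_count M (heavy M c) - c * size (heavy M c).

Definition submatrix (M : seq (seq bool)) (s : seq nat) : seq (seq bool) :=
  [seq [seq madj M x y | y <- s] | x <- s].

(** The comparison with [cap] tests whether [w] is at most the budget. Only the copy of the colour
    number used for computing is cut at the number of vertices; the output repeats the original
    numeral. The other output is a single edge with no colours and no budget, a no-instance. *)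
Definition kernel_code (x : seq (seq bool) * (seq bool * seq bool)) :=
  let M := x.1 in
  let c := cap (size M) x.2.1 in
  let w := weak_count M c in
  if cap w x.2.2 == w
  then (submatrix M (kept M c), (x.2.1, iter w bpred x.2.2))
  else ([:: [:: false; true]; [:: true; false]], ([::], [::])).

(** * Polynomial running time of the kernelization *)

Lemma polytime_owner S (eS : encodable S) (s : S -> slot) :
  polytime s -> polytime (fun x => owner (s x)).
Proof. by move=> Hs; rewrite /owner; poly. Qed.

Lemma polytime_occupants S (eS : encodable S) (s : S -> slot) :
  polytime s -> polytime (fun x => occupants (s x)).
Proof. by move=> Hs; rewrite /occupants; poly. Qed.

Lemma polytime_smalls : polytime (fun x => smalls x.1 x.2).
Proof.
by rewrite /smalls; have H := polytime_blobs; poly.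
Qed.

Lemma polytime_bigs : polytime (fun x => bigs x.1 x.2).
Proof.
by rewrite /bigs; have H := polytime_blobs; poly.
Qed.

Lemma polytime_slots0 : polytime (fun x => slots0 x.1 x.2).
Proof.
by rewrite /slots0; have H := polytime_bigs; poly.
Qed.

Lemma tsz_take_drop S {eS : encodable S} (d : S) s i :
  tsz (take i s) + tsz (nth d s i) + tsz (drop i.+1 s) <= tsz s + tsz d + 1.
Proof.
elim: s i => [|a s IH] [|i] /=.
- by rewrite tsz_nil; lia.
- by rewrite tsz_nil; lia.
- by rewrite drop0 tsz_nil tsz_cons; lia.
- by have := IH i; rewrite !tsz_cons; lia.
Qed.

(** A round moves blobs between the queue and the slots without copying them and raises one price by
    one, so the state grows only by a constant; 40 is a generous one. *)
Lemma tsz_bid M N st : tsz (bid M N st) <= tsz st + 40.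
Proof.
rewrite /bid; case: st => [[|A Q] S] /=; first by lia.
case: ifP => [ltpN|_]; last by rewrite !tsz_pair tsz_cons; lia.
set p := find _ _ in ltpN *; set i := find _ S.
have hasp : has (fun p => has (biddable M A p) S) (iota 0 N).
  by rewrite has_find size_iota.
have := nth_find 0 hasp; rewrite -/p nth_iota // add0n => hasS.
have /andP [/eqP Ep _] := nth_find (0, (0, [::])) hasS.
pose proof (tsz_take_drop ((0, (0, [::])) : slot) S i) as le_td; move: le_td.
move: Ep; rewrite -/i; case: (nth _ S i) => [v [p' o]] /= Ep.
rewrite /price /= in Ep; rewrite /occupants /owner /= -Ep.
have : tsz (o ++ Q) < tsz o + tsz Q.
  by rewrite -(@tsz_cat (seq nat)).
have : (tsz (take i S ++ (v, (p'.+1, [:: A])) :: drop i.+1 S)).+1 =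
   tsz (take i S) + tsz ((v, (p'.+1, [:: A])) :: drop i.+1 S).
  exact: (@tsz_cat slot).
rewrite !tsz_pair !tsz_cons !tsz_pair !tsz_cons !tsz_nil !tsz_nat.
set a := tsz (take i S ++ _); set b := tsz (o ++ Q).
lia.
Qed.

Lemma polytime_bid S (eS : encodable S) M N st :
  polytime M -> polytime N -> polytime st ->
  polytime (fun x : S => bid (M x) (N x) (st x)).
Proof.
move=> HM HN Hst.
apply: (polytime_comp (f := fun x => ((M x, N x), st x))
                      (g := fun y => bid y.1.1 y.1.2 y.2)); first by poly.
have Hb : polytime (fun y : ((seq (seq bool) * (seq nat)) * nat) * slot =>
                       biddable y.1.1.1 y.1.1.2 y.1.2 y.2).
  by rewrite /biddable; poly; rewrite /price /owner; poly.
rewrite /bid /biddable /owner /occupants /price.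
by poly.
Qed.

Lemma polytime_auction : polytime (fun x => auction x.1 x.2).
Proof.
rewrite /auction; apply: polytime_snd.
apply: (@polytime_iter_add _ _ _ _
  (fun x => bid x.1 (size (slots0 x.1 x.2)))
  (fun x => (smalls x.1 x.2, slots0 x.1 x.2)) _ (fun=> 40)).
- exact: polybound_const.
- by move=> x s; apply: tsz_bid.
- have H : polytime (fun y : seq (seq bool) * nat * (seq (seq nat) * seq slot) =>
      size (slots0 y.1.1 y.1.2)).
    apply: polytime_size_seq.
    exact: (polytime_comp (polytime_fst polytime_id) polytime_slots0).
  by apply: polytime_bid; poly.
- by apply: polytime_pair polytime_smalls polytime_slots0.
- have H := polytime_size_seq polytime_slots0.
  have H' := polytime_size_seq polytime_smalls.
  by poly.
Qed.

Lemma polytime_low S (eS : encodable S) (s : S -> seq slot) :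
  polytime s -> polytime (fun x => low (s x)).
Proof.
move=> Hs; apply: (polytime_comp (g := low) Hs).
by rewrite /low /gap /price; poly.
Qed.

Lemma polytime_low_owners :
  polytime (fun x => map owner (low (auction x.1 x.2))).
Proof.
apply: (polytime_map (h := fun _ s => owner s)).
  by apply: polytime_owner; poly.
exact: polytime_low polytime_auction.
Qed.

Lemma polytime_heavy : polytime (fun x => heavy x.1 x.2).
Proof.
rewrite /heavy.
have H := polytime_low_owners; have Hb := polytime_bigs.
apply: polytime_filter => //; cbv beta.
apply: polytime_negb; apply: polytime_mem; first by poly.
by apply: (polytime_comp (f := fst) _ H); poly.
Qed.

Lemma polytime_kept : polytime (fun x => kept x.1 x.2).
Proof.
rewrite /kept.
have H := polytime_low_owners; have Hb := polytime_bigs.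
apply: polytime_cat.
  apply: polytime_filter => //; cbv beta.
  apply: polytime_mem; first by poly.
  by apply: (polytime_comp (f := fst) _ H); poly.
do 2!apply: polytime_flatten.
apply: (polytime_map (h := fun _ s => occupants s)).
  by apply: polytime_occupants; poly.
exact: polytime_low polytime_auction.
Qed.

Lemma polytime_edge_count : polytime (fun x => edge_count x.1 x.2).
Proof. by rewrite /edge_count; poly. Qed.

Lemma polytime_weak_count : polytime (fun x => weak_count x.1 x.2).
Proof.
rewrite /weak_count; have H := polytime_heavy.
apply: polytime_subn; last by poly.
apply: (polytime_comp (f := fun x => (x.1, heavy x.1 x.2)) _ polytime_edge_count).
by poly.
Qed.

Lemma polytime_submatrix : polytime (fun x => submatrix x.1 x.2).
Proof. by rewrite /submatrix; poly. Qed.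

Lemma polytime_kernel_code : polytime kernel_code.
Proof.
pose mc (x : seq (seq bool) * (seq bool * seq bool)) := (x.1, cap (size x.1) x.2.1).
have Hmc : polytime mc.
  apply: polytime_pair; first by poly.
  by apply: polytime_cap; poly.
have Hw := polytime_comp Hmc polytime_weak_count.
have Hk := polytime_comp Hmc polytime_kept.
apply: polytime_if; last exact: polytime_const.
  apply: polytime_eqn => //; apply: polytime_cap => //; poly.
apply: polytime_pair.
  apply: (polytime_comp (f := fun x => (x.1, kept (mc x).1 (mc x).2)) _
            polytime_submatrix); by poly.
apply: polytime_pair; first by poly.
by apply: polytime_iter_bpred => //; poly.
Qed.

(** * Correctness of the binary arithmetic *)

Definition bits (n : nat) : seq bool :=
  if bin_of_nat n is Npos p then pos_bits p else [::].

Definition bits_val (bs : seq bool) : nat := foldr (fun (b : bool) v => b + v.*2) 0 bs.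

Lemma bits_val_gt0 b bs : last true (b :: bs) -> 0 < bits_val (b :: bs).
Proof. by elim: bs b => [[]|b' bs IH b] //= /IH /=; lia. Qed.

(** The condition [last true] says that the most significant bit is one; its default admits the
    empty numeral for zero. On such canonical numerals the value determines the bits, so [bpred] can
    be verified through values. *)
Lemma bits_val_inj bs1 bs2 : last true bs1 -> last true bs2 ->
  bits_val bs1 = bits_val bs2 -> bs1 = bs2.
Proof.
elim: bs1 bs2 => [|b1 bs1 IH] [|b2 bs2] // c1 c2 E.
- by have := bits_val_gt0 c2; rewrite -E.
- by have := bits_val_gt0 c1; rewrite E.
have -> : b1 = b2 by move: E; rewrite /=; case: b1 {c1} b2 {c2} => [] [] //=; lia.
congr (_ :: _); apply: IH.
- by case: bs1 c1 {E}.
- by case: bs2 c2 {E}.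
- by move: E; rewrite /= -/(bits_val bs1) -/(bits_val bs2);
  case: b1 b2 {c1 c2} => [] [] //=; lia.
Qed.

Lemma bits_last n : last true (bits n).
Proof.
rewrite /bits; case: (bin_of_nat n) => // p.
suff : forall d, last d (pos_bits p) by [].
by elim: p => /=.
Qed.

Lemma bits_valK n : bits_val (bits n) = n.
Proof.
rewrite /bits -[RHS]bin_of_natK; case: (bin_of_nat n) => //= p.
by elim: p => //= p ->; rewrite ?add1n ?add0n ?NatTrec.doubleE.
Qed.

Lemma nilp_bits n : nilp (bits n) = (n == 0).
Proof.
rewrite -[in RHS](bits_valK n); have := bits_last n.
by case: (bits n) => // b bs /bits_val_gt0; case: (bits_val _).
Qed.

Lemma bpred_val b bs : last true (b :: bs) ->
  last true (bpred (b :: bs)) /\ bits_val (bpred (b :: bs)) = (bits_val (b :: bs)).-1.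
Proof.
elim: bs b => [|b' bs IH] [] // c.
have [c1 e1] := IH b' c.
have -> : bpred [:: false, b' & bs] = true :: bpred (b' :: bs) by [].
split; first by [].
have := bits_val_gt0 c; rewrite /= in e1 *.
rewrite -/(bits_val _) e1 /= -/(bits_val bs); lia.
Qed.

Lemma bpred_bits n : bpred (bits n) = bits n.-1.
Proof.
have := bits_last n; have := bits_valK n.
case E: (bits n) => [|b bs] /= Ev c; first by rewrite -Ev.
have [c1 e1] := bpred_val c.
by apply: bits_val_inj; rewrite ?bits_last // e1 bits_valK -E bits_valK.
Qed.

Lemma iter_bpred_bits i n : iter i bpred (bits n) = bits (n - i).
Proof. by elim: i => [|i /= ->]; rewrite ?subn0 // bpred_bits subnS. Qed.

Lemma cap_bits n k : cap n (bits k) = minn n k.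
Proof.
rewrite /cap size_filter (eq_count (a2 := fun i => i < k)); last first.
  by move=> i; rewrite iter_bpred_bits nilp_bits subn_eq0 ltnNge.
elim: n => [|n IH]; first by rewrite min0n.
rewrite -addn1 iotaD count_cat IH /= add0n.
by case: ltnP; lia.
Qed.

(** * Blobs and the auction *)

Section Blobs.

Variables (M : seq (seq bool)) (c : nat).
Let n := size M.

(** Certificate of connectivity: vertices are added in front, so each one has a neighbour among
    those added before it. *)
Fixpoint grown (A : seq nat) : bool :=
  if A is y :: A' then (nilp A' || has (madj M y) A') && grown A' else true.

(** The suffix that starts at a blob contains exactly the vertices used up when that blob was
    closed; a small blob was closed because no other vertex was adjacent to it. The head may still
    be growing, so [blob_inv] asks for this only behind it. *)
Fixpoint sealed (Bs : seq (seq nat)) : Prop :=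
  if Bs is B :: Bs' then
    (size B <= c -> forall y, y < n -> y \notin flatten Bs ->
       ~~ has (madj M y) B) /\ sealed Bs'
  else True.

Definition blob_inv (Bs : seq (seq nat)) : Prop :=
  [/\ uniq (flatten Bs), all (fun y => y < n) (flatten Bs),
      all (fun B => [&& 0 < size B, size B <= c.+1 & grown B]) Bs
    & sealed (behead Bs)].

Lemma mem_unused y Bs : (y \in unused n Bs) = (y < n) && (y \notin flatten Bs).
Proof. by rewrite mem_filter mem_iota andbC. Qed.

Lemma grow_inv Bs : blob_inv Bs -> blob_inv (grow M c Bs).
Proof.
move=> [uB ltB aB sB]; rewrite /grow -/n.
have extend y r : unused n Bs = y :: r -> y < n /\ y \notin flatten Bs.
  by move=> E; apply/andP; rewrite -mem_unused E mem_head.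
case E: (if _ then _ else _) => [|y r].
  case ER: (unused n Bs) => [|y r] //.
  have [lty nBy] := extend _ _ ER.
  split=> /=; rewrite ?nBy ?lty ?uB ?ltB ?aB //.
  case: Bs uB ltB aB sB E ER {extend nBy} => //= A Bs uB ltB aB sB E ER.
  split=> // sA z ltz nz; move: E; rewrite sA ER -ER => E.
  apply/negP => hz.
  have : z \in [seq y <- unused n (A :: Bs) | has (madj M y) A].
    by rewrite mem_filter hz mem_unused ltz.
  by rewrite E.
case: ifP E => // sA E.
have : y \in [seq y <- unused n Bs | has (madj M y) (head [::] Bs)].
  by rewrite E mem_head.
rewrite mem_filter mem_unused => /and3P [hy lty nBy].
case: Bs uB ltB aB sB sA E hy nBy {extend} => //= A Bs uB ltB aB sB sA E hy nBy.
split=> //=; rewrite ?nBy ?lty //.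
move: aB => /andP [/and3P [_ _ gA] ->]; rewrite andbT ltnS sA gA andbT /=.
by rewrite hy orbT.
Qed.

Lemma size_grow Bs : blob_inv Bs ->
  minn n (size (flatten Bs)).+1 <= size (flatten (grow M c Bs)).
Proof.
move=> [uB ltB aB sB]; rewrite /grow -/n.
case E: (if _ then _ else _) => [|y r].
  case ER: (unused n Bs) => [|y r] /=; last by rewrite geq_minr.
  rewrite geq_min; apply/orP; left.
  rewrite -{1}(size_iota 0 n); apply: uniq_leq_size; first exact: iota_uniq.
  move=> y; rewrite mem_iota /= => lty; apply: contraT => nBy.
  by have := mem_unused y Bs; rewrite ER lty nBy.
by case: Bs {uB ltB aB sB E} => [|A Bs] /=; rewrite geq_minr.
Qed.

Lemma blobs_inv : blob_inv (blobs M c) /\ n <= size (flatten (blobs M c)).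
Proof.
have H k : blob_inv (iter k (grow M c) [::]) /\
           minn n k <= size (flatten (iter k (grow M c) [::])).
  elim: k => [|k [I le]]; first by rewrite minn0.
  split; first exact: grow_inv.
  by apply: leq_trans (size_grow I); move: le; rewrite leq_min; lia.
by have := H n; rewrite minnn.
Qed.

Lemma flatten_blobs_uniq : uniq (flatten (blobs M c)).
Proof. by have [[]] := blobs_inv. Qed.

Lemma mem_flatten_blobs y : (y \in flatten (blobs M c)) = (y < n).
Proof.
have [[uB /allP ltB _ _] le] := blobs_inv.
have sub : {subset flatten (blobs M c) <= iota 0 n}.
  by move=> z /ltB; rewrite mem_iota.
have [|_ ->] := uniq_min_size uB sub; first by rewrite size_iota.
by rewrite mem_iota.
Qed.

Lemma blobs_sealed : sealed (blobs M c).
Proof.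
have [[_ _ _]] := blobs_inv; have := mem_flatten_blobs.
case: (blobs M c) => //= A Bs E sB; split=> // _ y lty.
by rewrite E lty.
Qed.

Lemma blobP B : B \in blobs M c -> [/\ 0 < size B, size B <= c.+1 & grown B].
Proof. by have [[_ _ /allP H _] _] := blobs_inv => /H /and3P. Qed.

Lemma blob_uniq B : B \in blobs M c -> uniq B.
Proof.
have := flatten_blobs_uniq; elim: (blobs M c) => //= A Bs IH.
rewrite cat_uniq inE => /and3P [uA _ uB] /orP [/eqP -> //|]; exact: IH.
Qed.

Lemma blob_disjoint A B x :
  A \in blobs M c -> B \in blobs M c -> x \in A -> x \in B -> A = B.
Proof.
have := flatten_blobs_uniq; elim: (blobs M c) => //= C Bs IH.
rewrite cat_uniq !inE => /and3P [_ /hasPn nC uB].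
have nn D : D \in Bs -> x \in D -> x \notin C.
  by move=> DB xD; apply: nC; apply/flattenP; exists D.
move=> /orP [/eqP ->|AB] /orP [/eqP ->|BB] xA xB //.
- by have := nn _ BB xB; rewrite xA.
- by have := nn _ AB xA; rewrite xB.
- exact: IH.
Qed.

Lemma sealed_mem Bs B x : sealed Bs -> B \in Bs -> size B <= c ->
  x < n -> x \notin flatten Bs -> ~~ has (madj M x) B.
Proof.
elim: Bs => //= C Bs IH [sC sBs]; rewrite inE mem_cat negb_or.
move=> /orP [/eqP -> sB ltx /andP [nC nBs]|BB sB ltx /andP [nC nBs]].
  by apply: sC => //; rewrite mem_cat negb_or nC.
exact: IH.
Qed.

Lemma blob_nonadj (A B : seq nat) x y :
  (forall u v, madj M u v = madj M v u) ->
  A \in blobs M c -> B \in blobs M c -> A != B -> size A <= c -> size B <= c ->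
  x \in A -> y \in B -> ~~ madj M x y.
Proof.
move=> sym Ab Bb neAB sA sB xA yB.
have ltn_mem C z : C \in blobs M c -> z \in C -> z < n.
  by move=> Cb zC; rewrite -mem_flatten_blobs; apply/flattenP; exists C.
have ltx := ltn_mem _ _ Ab xA; have lty := ltn_mem _ _ Bb yB.
have := blobs_sealed; have := flatten_blobs_uniq.
elim: (blobs M c) Ab Bb => //= C Bs IH; rewrite !inE cat_uniq.
move=> AB BB /and3P [_ /hasPn nC uB] [sC sBs].
have nn z : z \in C -> z \notin flatten Bs.
  by move=> zC; apply/negP => /nC /=; rewrite zC.
case/orP: AB BB => [/eqP EA|AB] /orP [/eqP EB|BB].
- by rewrite EA EB eqxx in neAB.
- apply: contra (sealed_mem sBs BB sB ltx _); last by rewrite nn -?EA.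
  by move=> a; apply/hasP; exists y.
- rewrite sym; apply: contra (sealed_mem sBs AB sA lty _); last by rewrite nn -?EB.
  by move=> a; apply/hasP; exists x.
- exact: IH.
Qed.

Lemma mem_bigs v : (v \in bigs M c) = has (fun B => (c < size B) && (v \in B)) (blobs M c).
Proof.
apply/flattenP/hasP => [[B]|[B BB /andP [ltc vB]]].
  by rewrite mem_filter => /andP [ltc BB] vB; exists B => //; rewrite ltc.
by exists B => //; rewrite mem_filter ltc.
Qed.

Lemma bigs_uniq : uniq (bigs M c).
Proof.
rewrite /bigs; have := flatten_blobs_uniq.
elim: (blobs M c) => //= B Bs IH; rewrite cat_uniq => /and3P [uB /hasPn nB uBs].
case: ifP => _ /=; last exact: IH.
rewrite cat_uniq uB IH // andbT; apply/hasPn => y /flattenP [D].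
by rewrite mem_filter => /andP [_ DB] yD; apply: nB; apply/flattenP; exists D.
Qed.

Lemma size_bigs : size (bigs M c) = count (fun B => c < size B) (blobs M c) * c.+1.
Proof.
rewrite /bigs; have := @blobP; elim: (blobs M c) => //= B Bs IH H.
have {}IH := IH (fun D DB => H D (mem_behead (s := B :: Bs) DB)).
case: ifP => //= ltB; rewrite size_cat IH mulSn; congr (_ + _).
by have [_ le _] := H B (mem_head _ _); lia.
Qed.

Lemma smallsP B : reflect (B \in blobs M c /\ size B <= c) (B \in smalls M c).
Proof. by rewrite mem_filter andbC; exact: andP. Qed.

Lemma blob_flatten_uniq_list : uniq (blobs M c).
Proof.
have := flatten_blobs_uniq; have := @blobP.
elim: (blobs M c) => //= B Bs IH H; rewrite cat_uniq => /and3P [_ /hasPn nB uBs].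
rewrite IH // ?andbT => [|D DB]; last by apply: H; rewrite inE DB orbT.
apply/negP => BB; have [] := H B (mem_head _ _).
case: B nB BB {H} => // x B nB BB _ _ _.
have /nB : x \in flatten Bs by apply/flattenP; exists (x :: B); rewrite ?mem_head.
by rewrite /= mem_head.
Qed.

End Blobs.

(** * The auction and its invariant *)

Section Auction.

Variables (M : seq (seq bool)) (c : nat).
Let N := size (slots0 M c).

Notation wants A s := (has (madj M (owner s)) A).
Notation occ S := (flatten (map occupants S)).

Variant bid_spec : seq (seq nat) -> seq slot -> seq (seq nat) * seq slot -> Prop :=
| BidEnd S : bid_spec [::] S ([::], S)
| BidFail A Q S : {in S, forall s, wants A s -> N <= price s} ->
    bid_spec (A :: Q) S (Q, S)
| BidWin A Q S1 s S2 : wants A s -> price s < N ->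
    {in S1 ++ s :: S2, forall s', wants A s' -> price s <= price s'} ->
    bid_spec (A :: Q) (S1 ++ s :: S2)
      (occupants s ++ Q, S1 ++ (owner s, ((price s).+1, [:: A])) :: S2).

Lemma bidP Q S : bid_spec Q S (bid M N (Q, S)).
Proof.
rewrite /bid; case: Q => [|A Q] /=; first exact: BidEnd.
set p := find _ _; have fP q : q < p -> ~~ has (biddable M A q) S.
  move=> ltq; have := before_find 0 ltq; rewrite nth_iota => [/negbT//|].
  by apply: leq_trans ltq _; rewrite -[N in _ <= N](size_iota 0) find_size.
case: ifP => [ltp|/negbT].
  have hasp : has (fun p => has (biddable M A p) S) (iota 0 N).
    by rewrite has_find size_iota.
  have := nth_find 0 hasp; rewrite -/p nth_iota // add0n => hasS.
  have /andP [/eqP Ep wA] := nth_find (0, (0, [::])) hasS.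
  set i := find _ S in Ep wA *; set s := nth _ S i in Ep wA *.
  have ES : S = take i S ++ s :: drop i.+1 S.
    by rewrite -drop_nth -?has_find // cat_take_drop.
  rewrite {1}ES -Ep; apply: BidWin; rewrite ?Ep //.
  rewrite -ES => s' s'S ws'; rewrite leqNgt; apply/negP => /fP /hasPn /(_ _ s'S).
  by rewrite /biddable eqxx ws'.
rewrite -leqNgt => leN; apply: BidFail => s sS ws.
rewrite leqNgt; apply/negP => lts.
have /fP /hasPn /(_ _ sS) : price s < p by exact: leq_trans leN.
by rewrite /biddable eqxx ws.
Qed.

(** The fourth clause is approximate optimality: a winner paid one more than the cheapest adjacent
    price. The last clause concerns the discarded blobs. Both persist because prices never
    decrease. *)
Definition auction_inv (Q : seq (seq nat)) (S : seq slot) : Prop :=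
  [/\ map owner S = map owner (slots0 M c),
      uniq (Q ++ occ S) /\ {subset Q ++ occ S <= smalls M c},
      {in S, forall s, size (occupants s) = (0 < price s)},
      {in S, forall s, {in occupants s, forall A, wants A s /\
         {in S, forall s', wants A s' -> price s <= (price s').+1}}}
    & {in smalls M c, forall A, A \notin Q ++ occ S ->
         {in S, forall s, wants A s -> N <= price s}}].

Definition auction_measure (Q : seq (seq nat)) (S : seq slot) : nat :=
  size Q + \sum_(s <- S) (N - price s).

(** A failed bid shortens the queue. A successful one does not lengthen it, since a slot has at most
    one occupant to evict, and it uses up one price rise. *)
Lemma bid_inv Q S : auction_inv Q S ->
  auction_inv (bid M N (Q, S)).1 (bid M N (Q, S)).2 /\
  ((bid M N (Q, S)).1 = [::] \/
   auction_measure (bid M N (Q, S)).1 (bid M N (Q, S)).2 < auction_measure Q S).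
Proof.
case: bidP => {Q S} [S|A Q S fA|A Q S1 s S2 ws lts mins] /= I.
- by split; [|left].
- case: I => own [uQ sQ] szo oP uP; split; last by right; rewrite /auction_measure /=; lia.
  split=> //.
    split; first by case/andP: uQ.
    by move=> B BQ; apply: sQ; rewrite inE BQ orbT.
  move=> B BB nB; have [->|neBA] := eqVneq B A; first exact: fA.
  by apply: uP => //; rewrite inE negb_or neBA.
set s' := (owner s, ((price s).+1, [:: A])); set S := S1 ++ s :: S2 in mins I *.
set S' := S1 ++ s' :: S2.
case: I => own [uQ sQ] szo oP uP.
have sS : s \in S by rewrite mem_cat mem_head orbT.
have S'P t : t \in S' -> t = s' \/ t \in S.
  rewrite !mem_cat !inE => /or3P [->|/eqP ->|->]; [right|left|right] => //.
  by rewrite !orbT.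
have mono B k : {in S, forall t, wants B t -> k <= price t} ->
    {in S', forall t, wants B t -> k <= price t}.
  move=> H t /S'P [-> w|]; last exact: H.
  by apply: leq_trans (H s sS w) _; rewrite /price /= leqnSn.
(* Queue and occupants together are merely permuted, so uniqueness and the set of discarded blobs do
   not change. *)
have pQ : perm_eq ((occupants s ++ Q) ++ occ S') (A :: Q ++ occ S).
  apply/permP => P; rewrite /= /S /S' !map_cat !flatten_cat /= !count_cat /=.
  by lia.
split; last first.
  right; rewrite /auction_measure /S /S' !big_cat !big_cons /= size_cat.
  have Ep : price s' = (price s).+1 by [].
  by rewrite Ep (szo s sS); case: (0 < _) => /=; lia.
split.
- by move: own; rewrite /S /S' !map_cat.
- split; first by rewrite (perm_uniq pQ).
  by move=> B; rewrite (perm_mem pQ); exact: sQ.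
- by move=> t /S'P [-> //|]; exact: szo.
- move=> t /S'P [->|tS] B.
    rewrite inE => /eqP ->; split=> // t' t'S' w.
    by rewrite /price /= ltnS; apply: mono w => // t'' /mins.
  move=> /(oP t tS) [w H]; split=> // t' t'S' w'.
  have le : {in S, forall u, wants B u -> (price t).-1 <= price u}.
    by move=> u uS wu; rewrite -subn1 leq_subLR add1n; exact: H.
  by have := mono _ _ le t' t'S' w'; lia.
- move=> B BB nB; apply: mono; apply: uP => //.
  by rewrite cat_cons -(perm_mem pQ).
Qed.

Lemma auction_inv0 : auction_inv (smalls M c) (slots0 M c).
Proof.
have H s : s \in slots0 M c -> occupants s = [::] /\ price s = 0.
  by move=> /flattenP [l /mapP [v _ ->]] /nseqP [-> _].
have E : occ (slots0 M c) = [::].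
  elim: (slots0 M c) H => //= s S IH H.
  rewrite (H s (mem_head _ _)).1 IH // => t tS; apply: H.
  by rewrite inE tS orbT.
split=> //.
- by rewrite E cats0; split=> //; rewrite filter_uniq // blob_flatten_uniq_list.
- by move=> s /H [-> ->].
- by move=> s /H [-> _].
- by move=> A AB; rewrite E cats0 AB.
Qed.

Lemma auction_final : auction_inv [::] (auction M c).
Proof.
set T := size (smalls M c) + N * N.
have E0 : auction_measure (smalls M c) (slots0 M c) = T.
  rewrite /auction_measure /T; congr (_ + _).
  rewrite big_seq (eq_bigr (fun=> N)) => [|s]; last first.
    by move=> /flattenP [l /mapP [v _ ->]] /nseqP [-> _]; rewrite subn0.
  by rewrite -big_seq big_const_seq count_predT iter_addn_0 mulnC.
have H k : let st := iter k (bid M N) (smalls M c, slots0 M c) in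
    auction_inv st.1 st.2 /\ (st.1 = [::] \/ auction_measure st.1 st.2 + k <= T).
  elim: k => [|k]; first by split; [exact: auction_inv0|right; rewrite addn0 E0].
  rewrite iterS /=; case: (iter k _ _) => Q S /= [I H].
  have [I' H'] := bid_inv I; split=> //.
  case: H' => [|lt]; first by left.
  case: H => [EQ|le]; last by right; lia.
  by left; rewrite EQ.
(* After [T] rounds the queue is empty or the measure, which bounds its length, is 0. *)
have [] := H T; rewrite /auction -/N -/T.
case: (iter _ _ _) => Q S /= I [EQ|le]; first by rewrite EQ in I.
have EQ : Q = [::] by apply: size0nil; move: le; rewrite /auction_measure; lia.
by rewrite EQ in I.
Qed.

End Auction.

Lemma uniq_flatten_map_inj (S T : eqType) (f : S -> seq T) s x y a :
  uniq (flatten (map f s)) -> x \in s -> y \in s -> a \in f x -> a \in f y ->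
  x = y.
Proof.
elim: s => //= z s IH; rewrite cat_uniq !inE => /and3P [_ /hasPn nz us].
have nn w : w \in s -> a \in f w -> a \notin f z.
  by move=> ws aw; apply: nz; apply/flatten_mapP; exists w.
move=> /orP [/eqP ->|xs] /orP [/eqP ->|ys] ax ay //.
- by have := nn _ ys ay; rewrite ax.
- by have := nn _ xs ax; rewrite ay.
- exact: IH.
Qed.

Lemma uniq_flatten_map_filter (S T : eqType) (f : S -> seq T) s p :
  uniq (flatten (map f s)) -> uniq (flatten (map f (filter p s))).
Proof.
elim: s => //= z s IH; rewrite cat_uniq => /and3P [uz /hasPn nz us].
case: ifP => _ /=; last exact: IH.
rewrite cat_uniq uz IH // andbT; apply/hasPn => a /flatten_mapP [w].
by rewrite mem_filter => /andP [_ ws] aw; apply: nz; apply/flatten_mapP; exists w.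
Qed.

(** * Heavy vertices, removed blobs and kept vertices *)

Section Expansion.

Variables (M : seq (seq bool)) (c : nat).
Hypothesis madj_sym : forall x y, madj M x y = madj M y x.
Let n := size M.
Let S := auction M c.
Let l := gap S.

Notation wants A s := (has (madj M (owner s)) A).
Notation occ s := (flatten (map occupants s)).

Lemma size_auction : size S = c * size (bigs M c).
Proof.
have [own _ _ _ _] := auction_final M c.
rewrite -(size_map owner) own size_map /slots0.
by elim: (bigs M c) => [|v D IH] /=; rewrite ?muln0 // size_cat size_nseq IH mulnS.
Qed.

Lemma size_slots0 : size (slots0 M c) = size S.
Proof.
by have [own _ _ _ _] := auction_final M c; rewrite -(size_map owner) -own size_map.
Qed.

Lemma gapP : l <= size S /\ {in S, forall s, price s != l}.
Proof.
have hasl : has (fun p => ~~ has (fun s => price s == p) S) (iota 0 (size S).+1).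
  apply: contraT => /hasPn H.
  have : size (iota 0 (size S).+1) <= size (map price S).
    apply: uniq_leq_size; first exact: iota_uniq.
    by move=> p /H /negPn /hasP [s sS /eqP <-]; exact: map_f.
  by rewrite size_iota size_map ltnn.
have := nth_find 0 hasl; have := hasl; rewrite has_find size_iota => ltl.
rewrite -/(gap S) -/l in ltl *.
rewrite nth_iota // add0n => /hasPn H; split; first by rewrite -ltnS.
exact: H.
Qed.

Definition removed : seq (seq nat) :=
  [seq B <- smalls M c | B \notin occ (low S)].

Lemma low_sub : {subset occ (low S) <= smalls M c}.
Proof.
have [_ [_ sub] _ _ _] := auction_final M c.
move=> B /flatten_mapP [s]; rewrite mem_filter => /andP [_ sS] Bs.
by apply: sub; apply/flatten_mapP; exists s.
Qed.

(** Small blobs are not adjacent to each other. Suppose a big neighbour [y] had a slot of price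
    below [l]. If [B] occupies a slot, the price of this slot exceeds [l], as no price equals [l],
    yet it is at most one more than that of [y]'s slot. If [B] was discarded, all its adjacent
    prices are at least the number of slots, hence at least [l]. Both are contradictions. *)
Lemma removed_closed B x y : B \in removed -> x \in B -> y < n -> madj M x y ->
  y \in B \/ y \in heavy M c.
Proof.
rewrite mem_filter => /andP [nlow Bsm] xB lty axy.
have [BB leB] := smallsP _ _ _ Bsm.
have : y \in flatten (blobs M c) by rewrite mem_flatten_blobs.
move=> /flattenP [A AB yA]; have [leA|ltA] := leqP (size A) c.
  left; have [<- //|ne] := eqVneq A B.
  have := blob_nonadj madj_sym BB AB _ leB leA xB yA.
  by rewrite axy eq_sym => /(_ ne).
right; rewrite mem_filter mem_bigs; apply/andP; split; last first.
  by apply/hasP; exists A; rewrite ?ltA.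
apply/mapP => -[s]; rewrite mem_filter -/S -/l => /andP [lts sS] Ey.
have wB : wants B s by apply/hasP; exists x; rewrite // -Ey madj_sym.
have [_ _ _ oP uP] := auction_final M c.
have [leN gP] := gapP.
have [|nB] := boolP (B \in occ S).
  move=> /flatten_mapP [t tS Bt].
  have [_ /(_ s sS wB) let'] := oP t tS B Bt.
  have : ~~ (price t < l).
    apply: contra nlow => ltt; apply/flatten_mapP; exists t => //.
    by rewrite mem_filter ltt.
  by move: (gP t tS) let' lts; clear; lia.
move: (uP B Bsm nB s sS wB); rewrite size_slots0.
by move: leN lts; clear; lia.
Qed.

Definition private (v : nat) : seq (seq nat) := occ [seq s <- S | owner s == v].

Lemma heavy_slot v s : v \in heavy M c -> s \in S -> owner s = v -> l < price s.
Proof.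
rewrite mem_filter -/S => /andP [nlow _] sS Es.
have : ~~ (price s < l).
  apply: contra nlow => lts; apply/mapP; exists s => //.
  by rewrite mem_filter lts.
by have := gapP.2 s sS; lia.
Qed.

(** The vertex has [c] slots, and each has a price above [l], thus positive, which means that it is
    occupied. *)
Lemma size_private v : v \in heavy M c -> size (private v) = c.
Proof.
move=> vH; have [own _ szo _ _] := auction_final M c.
rewrite /private size_flatten /shape -map_comp.
have -> : [seq (size \o occupants) s | s <- S & owner s == v] =
          nseq (count (fun s => owner s == v) S) 1.
  have : {in S, forall s, owner s == v -> size (occupants s) = 1}.
    move=> s sS /eqP Es; rewrite szo //; have := heavy_slot vH sS Es.
    by case: (price s).
  elim: (S) => //= s s' IH H.
  have {}IH := IH (fun t ts => H t (mem_behead (s := s :: s') ts)).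
  by case: ifP => //= e; rewrite IH H ?mem_head.
rewrite sumn_nseq mul1n -(count_map owner (pred1 v)) own.
rewrite /slots0 count_map count_flatten -map_comp.
have : v \in bigs M c by move: vH; rewrite mem_filter => /andP [].
have := bigs_uniq M c; elim: (bigs M c) => //= w D IH /andP [nw uD].
rewrite count_nseq /= inE => /orP [/eqP ->|vD].
  rewrite /owner /= eqxx mul1n [X in _ + X](_ : _ = 0) ?addn0 //.
  elim: (D) nw => //= a D' IH'; rewrite inE negb_or => /andP [ne nw].
  by rewrite count_nseq IH' // addn0 /= /owner /= eq_sym (negbTE ne).
rewrite IH // (_ : (w == v) = false) //.
by apply/negbTE; apply: contra nw => /eqP ->.
Qed.

Lemma privateP v B : v \in heavy M c -> B \in private v ->
  B \in removed /\ exists2 u, u \in B & madj M v u.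
Proof.
move=> vH /flatten_mapP [s]; rewrite mem_filter => /andP [/eqP Es sS] Bs.
have [_ [uS sub] _ oP _] := auction_final M c.
have [/hasP [u uB au] _] := oP s sS B Bs.
split; last by exists u; rewrite // -Es.
rewrite mem_filter sub ?andbT; last by apply/flatten_mapP; exists s.
apply/flatten_mapP => -[t]; rewrite mem_filter -/l => /andP [ltt tS] Bt.
have Est := uniq_flatten_map_inj uS sS tS Bs Bt.
by have := heavy_slot vH sS Es; rewrite Est; lia.
Qed.

Lemma private_uniq v : uniq (private v).
Proof.
by have [_ [uS _] _ _ _] := auction_final M c; exact: uniq_flatten_map_filter.
Qed.

Lemma private_inj v v' B : B \in private v -> B \in private v' -> v = v'.
Proof.
move=> /flatten_mapP [s]; rewrite mem_filter => /andP [/eqP <- sS] Bs.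
move=> /flatten_mapP [t]; rewrite mem_filter => /andP [/eqP <- tS] Bt.
have [_ [uS _] _ _ _] := auction_final M c.
by rewrite (uniq_flatten_map_inj uS sS tS Bs Bt).
Qed.

Lemma flatten_uniq_blobs L : uniq L -> {subset L <= blobs M c} ->
  uniq (flatten L).
Proof.
elim: L => //= B L IH /andP [nB uL] sub; rewrite cat_uniq.
have BB := sub _ (mem_head _ _).
rewrite (blob_uniq BB) IH // ?andbT => [|A AL]; last by apply: sub; rewrite inE AL orbT.
apply/hasPn => x /flattenP [A AL xA]; apply: contra nB => xB.
by rewrite (blob_disjoint BB _ xB xA) // sub // inE AL orbT.
Qed.

Lemma occ_low_uniq : uniq (occ (low S)).
Proof.
by have [_ [uS _] _ _ _] := auction_final M c; exact: uniq_flatten_map_filter.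
Qed.

Lemma big_small v B : v \in bigs M c -> B \in smalls M c -> v \notin B.
Proof.
rewrite mem_bigs => /hasP [A AB /andP [ltA vA]] /smallsP [BB leB].
by apply: contraL ltA => vB; rewrite -leqNgt (blob_disjoint AB BB vA vB).
Qed.

Lemma kept_uniq : uniq (kept M c).
Proof.
rewrite /kept cat_uniq filter_uniq ?bigs_uniq //=.
rewrite flatten_uniq_blobs ?occ_low_uniq // ?andbT => [|B /low_sub /smallsP [] //].
apply/hasPn => x /flattenP [B /low_sub Bs xB]; rewrite mem_filter negb_and.
by apply/orP; right; apply: contraL xB => xD; exact: big_small.
Qed.

Lemma heavy_uniq : uniq (heavy M c).
Proof. by rewrite filter_uniq ?bigs_uniq. Qed.

Lemma mem_bigs_lt v : v \in bigs M c -> v < n.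
Proof.
rewrite mem_bigs => /hasP [A AB /andP [_ vA]].
by rewrite -(mem_flatten_blobs M c); apply/flattenP; exists A.
Qed.

Lemma small_lt B x : B \in smalls M c -> x \in B -> x < n.
Proof.
move=> /smallsP [BB _] xB.
by rewrite -(mem_flatten_blobs M c); apply/flattenP; exists B.
Qed.

Lemma removed_uniq : uniq (flatten removed).
Proof.
apply: flatten_uniq_blobs => [|B].
  by rewrite filter_uniq // filter_uniq // blob_flatten_uniq_list.
by rewrite mem_filter => /andP [_ /smallsP []].
Qed.

Lemma removed_small B : B \in removed -> B \in smalls M c.
Proof. by rewrite mem_filter => /andP []. Qed.

Lemma vertex_partition :
  perm_eq (iota 0 n) (kept M c ++ heavy M c ++ flatten removed).
Proof.
apply: uniq_perm; first exact: iota_uniq.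
- rewrite cat_uniq kept_uniq cat_uniq heavy_uniq removed_uniq /= !andbT.
  apply/andP; split; apply/hasPn => x.
    rewrite !mem_cat => /orP [|/flattenP [B Br xB]].
      rewrite !mem_filter => /andP [nlow xD]; rewrite (negbTE nlow) /=.
      by apply/flattenP => -[B /low_sub Bs]; apply/negP; exact: big_small.
    rewrite mem_filter negb_or negb_and; apply/andP; split.
      apply/orP; right; apply: contraL xB => xD.
      exact: big_small (removed_small Br).
    apply/flattenP => -[A Al xA].
    have [[AB _] [BB _]] := (smallsP _ _ _ (low_sub Al), smallsP _ _ _ (removed_small Br)).
    move: Br; rewrite mem_filter -(blob_disjoint AB BB xA xB).
    by rewrite -/S Al.
  move=> /flattenP [B Br xB]; rewrite mem_filter negb_and; apply/orP; right.
  by apply: contraL xB => xD; exact: big_small (removed_small Br).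
- move=> x; rewrite mem_iota /= add0n !mem_cat.
  apply/idP/idP => [|/or3P].
    rewrite -(mem_flatten_blobs M c) => /flattenP [B BB xB].
    have [leB|ltB] := leqP (size B) c.
      have Bs : B \in smalls M c by apply/smallsP.
      have [Bl|nBl] := boolP (B \in occ (low S)).
        by apply/orP; left; apply/orP; right; apply/flattenP; exists B.
      apply/orP; right; apply/orP; right; apply/flattenP; exists B => //.
      by rewrite mem_filter nBl.
    have xD : x \in bigs M c by rewrite mem_bigs; apply/hasP; exists B; rewrite ?ltB.
    rewrite /heavy !mem_filter xD !andbT.
    by case: (x \in map owner _) => //=; rewrite orbT.
  case; [|by rewrite mem_filter => /andP [_ /mem_bigs_lt]|].
    case/orP; first by rewrite mem_filter => /andP [_ /mem_bigs_lt].
    by move=> /flattenP [B /low_sub]; exact: small_lt.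
  by move=> /flattenP [B /removed_small]; exact: small_lt.
Qed.

(** Each big vertex has [c] slots, and each slot keeps at most one blob of at most [c] vertices. *)
Lemma size_kept : size (kept M c) <= (1 + c * c) * size (bigs M c).
Proof.
rewrite /kept size_cat mulnDl mul1n; apply: leq_add.
  by rewrite size_filter count_size.
rewrite -mulnA -size_auction; have [_ [_ sub] szo _ _] := auction_final M c.
apply: (@leq_trans (c * size (low S))); last first.
  by rewrite leq_mul2l size_filter count_size orbT.
have : {in low S, forall s, size (flatten (occupants s)) <= c}.
  move=> s; rewrite mem_filter => /andP [_ sS].
  have := szo s sS; case E: (occupants s) => [|A [|]] //= H; last by case: (0 < _) H.
  rewrite cats0; have /smallsP [] // : A \in smalls M c.
  by apply: sub; apply/flatten_mapP; exists s; rewrite // E mem_head.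
rewrite -/S; elim: (low S) => //= s s' IH H.
rewrite !flatten_cat size_cat mulnS leq_add ?H ?mem_head //.
by apply: IH => t ts; apply: H; rewrite inE ts orbT.
Qed.

End Expansion.

(** * Colourings and the reduction *)

Lemma sum_sym_rel (T : Type) (s : seq T) (f : T -> nat) (r : rel T) :
  symmetric r -> (forall x y, r x y -> f x != f y) ->
  \sum_(x <- s) \sum_(y <- s) r x y =
  (\sum_(x <- s) \sum_(y <- s) ((f x < f y) && r x y)).*2.
Proof.
move=> sr ir; rewrite -addnn [X in _ = X + _]exchange_big /= -big_split /=.
apply: eq_bigr => x _; rewrite -big_split /=; apply: eq_bigr => y _.
by rewrite [r y x]sr; have := ir x y;
case: (r x y) => [/(_ isT)|_]; rewrite ?andbT ?andbF //; lia.
Qed.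

Section EdgeSets.

Variable V : finType.

Lemma set2_inj (i j i' j' : V) : [set i; j] = [set i'; j'] ->
  (i = i' /\ j = j') \/ (i = j' /\ j = i').
Proof.
move=> E; have : i \in [set i'; j'] by rewrite -E !inE eqxx.
have : j \in [set i'; j'] by rewrite -E !inE eqxx orbT.
have : i' \in [set i; j] by rewrite E !inE eqxx.
have : j' \in [set i; j] by rewrite E !inE eqxx orbT.
rewrite !inE.
by do 4!(case/orP=> /eqP ?); subst; auto.
Qed.

Definition edge_set (r : rel V) : {set {set V}} :=
  [set A | [exists x, exists y, r x y && (A == [set x; y])]].

Lemma edge_setP (r : rel V) A :
  reflect (exists x y, r x y /\ A = [set x; y]) (A \in edge_set r).
Proof.
rewrite inE; apply: (iffP existsP) => [[x /existsP [y /andP [rxy /eqP ->]]]|].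
  by exists x, y.
by move=> [x [y [rxy ->]]]; exists x; apply/existsP; exists y; rewrite rxy eqxx.
Qed.

End EdgeSets.

Lemma card_edge_set m (r : rel 'I_m) : symmetric r -> irreflexive r ->
  \sum_i \sum_j (r i j : nat) = #|edge_set r|.*2.
Proof.
move=> sr ir; rewrite (@sum_sym_rel _ _ (fun i : 'I_m => i : nat)) //; last first.
  by move=> x y; apply: contraTneq => /val_inj ->; rewrite ir.
congr _.*2; rewrite pair_big /=.
pose P := [set p : 'I_m * 'I_m | (p.1 < p.2) && r p.1 p.2].
transitivity #|P|.
  rewrite -sum1_card [RHS]big_mkcond /=; apply: eq_bigr => p _.
  by rewrite inE; case: (_ && _).
have -> : edge_set r = [set [set p.1; p.2] | p in P].
  apply/setP => A; apply/edge_setP/imsetP => [[x [y [rxy ->]]]|[[x y]]].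
    case: (ltngtP x y) => [lt|gt|/val_inj E].
    - by exists (x, y); rewrite // inE /= lt rxy.
    - by exists (y, x); [rewrite inE /= gt sr rxy | rewrite /= setUC].
    - by move: rxy; rewrite E ir.
  by rewrite inE /= => /andP [_ rxy] ->; exists x, y.
rewrite card_in_imset // => -[x y] [x' y'];
rewrite !inE /= => /andP [lt _] /andP [lt' _].
by move=> /set2_inj [[-> ->]//|[E1 E2]]; move: lt lt'; rewrite E1 E2; lia.
Qed.

(* The weak edges are those of colour at least [c]; they are counted as ordered
   pairs, hence twice. *)
Definition colorable (M : seq (seq bool)) (s : seq nat) (c k : nat) : Prop :=
  exists g : nat -> nat -> nat,
    [/\ {in s &, forall x y, g x y = g y x},
        forall x y z, x \in s -> y \in s -> z \in s -> madj M x y ->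
          madj M x z -> g x y < c -> g x y = g x z -> y = z
      & \sum_(x <- s) \sum_(y <- s) (madj M x y && (c <= g x y)) <= k.*2].

Lemma ECS_colorable (M : seq (seq bool)) (s : seq nat) (G : graph) (c k : nat) :
  uniq s -> size s = nverts G ->
  (forall i j : vertex G, adj i j = madj M (nth 0 s i) (nth 0 s j)) ->
  ECS (ECSInstance G c k) <-> colorable M s c k.
Proof.
move=> us szs adjE; pose v (i : vertex G) := nth 0 s i.
have vs i : v i \in s by rewrite mem_nth // szs.
have sumE (F : nat -> nat -> nat) :
    \sum_(x <- s) \sum_(y <- s) F x y =
    \sum_(i : vertex G) \sum_(j : vertex G) F (v i) (v j).
  rewrite (big_nth 0) big_mkord szs; apply: eq_bigr => i _.
  by rewrite (big_nth 0) big_mkord szs.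
have edgesE : edges G = edge_set (@adj G) by [].
split.
  move=> [S [W [[/= dS dW EW] pS leW]]].
  (* Everything outside the strong classes receives colour [c], which counts as weak. *)
  pose h (i j : vertex G) : nat := if [pick a | [set i; j] \in S a] is Some a then a else c.
  have hP i j : h i j < c -> exists2 a, [set i; j] \in S a & h i j = a :> nat.
    by rewrite /h; case: pickP => [a aS _|]; [exists a | rewrite ltnn].
  have hsym i j : h i j = h j i by rewrite /h setUC.
  (* [h] is transported along the positions in [s]; the value 0 outside [s] is arbitrary. *)
  pose g x y := if insub (index x s) is Some i then
                  if insub (index y s) is Some j then h i j else 0 else 0.
  have gv i j : g (v i) (v j) = h i j.
    rewrite /g /v !index_uniq ?szs ?ltn_ord //.
    by rewrite !valK.
  have vP x : x \in s -> exists i, x = v i.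
    move=> xs; have lt : index x s < nverts G by rewrite -szs index_mem.
    by exists (Ordinal lt); rewrite /v nth_index.
  exists g; split.
  - by move=> x y /vP [i ->] /vP [j ->]; rewrite !gv.
  - move=> x y z /vP [i ->] /vP [j ->] /vP [l ->].
    rewrite !gv -!adjE => aij ail lt E.
    have [a aS Ea] := hP i j lt; rewrite E in lt.
    have [b bS Eb] := hP i l lt.
    have Eab : a = b by apply: val_inj; rewrite /= -Ea -Eb.
    congr v; apply/eqP; apply: contraT => nejl.
    have := pS [set i; j] [set i; l] _ _ _ _ a; rewrite aS Eab bS /=; apply.
    + by rewrite edgesE; apply/edge_setP; exists i, j.
    + by rewrite edgesE; apply/edge_setP; exists i, l.
    + apply: contra nejl => /eqP /set2_inj [[_ ->] //|[E1 E2]].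
      by rewrite E2 E1.
    + by apply/set0Pn; exists i; rewrite !inE eqxx.
  - rewrite sumE; pose r : rel (vertex G) := fun i j => adj i j && (c <= h i j).
    rewrite (eq_bigr (fun i => \sum_j (r i j : nat))); last first.
      by move=> i _; apply: eq_bigr => j _; rewrite gv -adjE.
    rewrite card_edge_set; first last.
    + by move=> i; rewrite /r adj_irr.
    + by move=> i j; rewrite /r adj_sym hsym.
    rewrite leq_double; apply: leq_trans leW; apply: subset_leq_card.
    apply/subsetP => A /edge_setP [i [j [/andP [aij le] ->]]].
    have : [set i; j] \in edges G by rewrite edgesE; apply/edge_setP; exists i, j.
    rewrite -EW inE => /orP [/bigcupP [a _ aS]|//].
    move: le; rewrite /h; case: pickP => [b _|/(_ a)]; last by rewrite aS.
    by rewrite leqNgt ltn_ord.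
move=> [g [gs gp gk]].
pose h (i j : vertex G) := g (v i) (v j).
have hsym i j : h i j = h j i by rewrite /h gs.
pose S (a : 'I_c) := edge_set [rel i j : vertex G | adj i j && (h i j == a)].
pose W := edge_set [rel i j : vertex G | adj i j && (c <= h i j)].
have hE i j i' j' : [set i; j] = [set i'; j'] -> h i j = h i' j'.
  by move=> /set2_inj [[-> ->]|[-> ->]].
exists S, W; split=> /=.
- split.
  + move=> a b neab; rewrite disjoint_subset; apply/subsetP => A.
    move=> /edge_setP [i [j [/andP [_ /eqP Ea] ->]]]; rewrite inE.
    apply/negP => /edge_setP [i' [j' [/andP [_ /eqP Eb] /hE E]]].
    by move: neab; rewrite -(inj_eq val_inj) /= -Ea -Eb E eqxx.
  + move=> a; rewrite disjoint_subset; apply/subsetP => A.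
    move=> /edge_setP [i [j [/andP [_ /eqP Ea] ->]]]; rewrite inE.
    apply/negP => /edge_setP [i' [j' [/andP [_ le] /hE E]]].
    by move: le; rewrite -E Ea leqNgt ltn_ord.
  + apply/setP => A; rewrite edgesE inE; apply/orP/edge_setP.
      case=> [/bigcupP [a _]|] /edge_setP [i [j [/andP [aij _] ->]]];
        by exists i, j.
    move=> [i [j [aij ->]]]; have [le|lt] := leqP c (h i j).
      by right; apply/edge_setP; exists i, j; rewrite /= aij.
    left; apply/bigcupP; exists (Ordinal lt) => //.
    by apply/edge_setP; exists i, j; rewrite /= aij eqxx.
- move=> A B _ _ neAB /set0Pn [x]; rewrite inE => /andP [xA xB] a.
  have aP C : C \in S a -> x \in C -> exists y, [/\ adj x y, h x y = a & C = [set x; y]].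
    move=> /edge_setP [i [j [/andP [aij /eqP Ea] ->]]]; rewrite !inE.
    case/orP=> /eqP ->; first by exists j.
    by exists i; rewrite adj_sym hsym setUC.
  apply/negP => /andP [/aP /(_ xA) [y [axy hy EA]] /aP /(_ xB) [z [axz hz EB]]].
  move: neAB; rewrite EA EB; apply/negP; rewrite negbK.
  have E : v y = v z.
    apply: (gp (v x)); rewrite ?vs -?adjE //; rewrite -/(h x y) -?/(h x z).
      by rewrite hy ltn_ord.
    by rewrite hy hz.
  move/eqP: E; rewrite nth_uniq ?szs ?ltn_ord // => /eqP /val_inj ->.
  by rewrite eqxx.
- rewrite -leq_double; apply: leq_trans gk; rewrite sumE -card_edge_set.
  + by apply: leq_sum => i _; apply: leq_sum => j _; rewrite /= adjE.
  + by move=> i j /=; rewrite adj_sym hsym.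
  + by move=> i /=; rewrite adj_irr.
Qed.

Lemma sum_restrict (T : eqType) (A V : seq T) (f : T -> nat) :
  uniq A -> uniq V -> {subset A <= V} ->
  \sum_(x <- V) (x \in A) * f x = \sum_(x <- A) f x.
Proof.
move=> uA uV sAV; transitivity (\sum_(x <- V | x \in A) f x).
  rewrite [RHS]big_mkcond; apply: eq_bigr => x _.
  by case: (x \in A); rewrite ?mul1n.
rewrite -big_filter; apply: perm_big; apply: uniq_perm => //.
  exact: filter_uniq.
by move=> x; rewrite mem_filter; case xA: (x \in A) => //=; exact: sAV.
Qed.

Lemma sum_nat_count (T : Type) (s : seq T) (b : pred T) :
  \sum_(x <- s) b x = count b s.
Proof. by elim: s => [|x s IH]; rewrite ?big_nil ?big_cons //= IH. Qed.

Lemma muln_sumr (T : Type) (s : seq T) (F : T -> nat) a :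
  a * \sum_(x <- s) F x = \sum_(x <- s) a * F x.
Proof. exact: big_distrr. Qed.

Lemma sum_const_seq (T : Type) (s : seq T) a : \sum_(x <- s) a = a * size s.
Proof. by rewrite big_const_seq count_predT iter_addn_0. Qed.

(** * Deleting heavy vertices and removed blobs preserves colourability *)

Section Reduction.

(** [K] stands for the kept vertices, [H] for the heavy ones and [R] for those of the removed blobs.
    The pendant edge from [v] to [leaf v j] is to receive colour [j]; different pairs [(v, j)] use
    different blobs. *)
Variables (M : seq (seq bool)) (V K H R : seq nat) (c : nat).
Variables (blob : nat -> seq nat) (leaf : nat -> nat -> nat).

Hypothesis madj_sym : forall x y, madj M x y = madj M y x.
Hypothesis madj_irr : forall x, madj M x x = false.
Hypothesis V_uniq : uniq V.
Hypothesis V_partition : perm_eq V (K ++ H ++ R).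
Hypothesis blob_mem : {in R, forall x, x \in blob x}.
Hypothesis blob_size : {in R, forall x, size (blob x) <= c}.
Hypothesis R_closed : forall x y, x \in R -> y \in V -> madj M x y ->
  y \in H \/ y \in R /\ blob y = blob x.
Hypothesis leafP : forall v j, v \in H -> j < c ->
  leaf v j \in R /\ madj M v (leaf v j).
Hypothesis leaf_blob_inj : forall v v' j j', v \in H -> v' \in H -> j < c -> j' < c ->
  blob (leaf v j) = blob (leaf v' j') -> v = v' /\ j = j'.

Let inc x y := (x \in H) || (y \in H).
Notation sumVV F := (\sum_(x <- V) \sum_(y <- V) F x y).

Let uKHR : uniq (K ++ H ++ R).
Proof. by rewrite -(perm_uniq V_partition). Qed.

Let memV x : (x \in V) = [|| x \in K, x \in H | x \in R].
Proof. by rewrite (perm_mem V_partition) !mem_cat. Qed.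

Let uK : uniq K. Proof. by move: uKHR; rewrite cat_uniq => /and3P []. Qed.
Let uH : uniq H.
Proof. by move: uKHR; rewrite !cat_uniq => /and3P [_ _ /and3P []]. Qed.
Let uR : uniq R.
Proof. by move: uKHR; rewrite !cat_uniq => /and3P [_ _ /and3P []]. Qed.

Let sKV : {subset K <= V}. Proof. by move=> x xK; rewrite memV xK. Qed.
Let sHV : {subset H <= V}. Proof. by move=> x xH; rewrite memV xH orbT. Qed.
Let sRV : {subset R <= V}. Proof. by move=> x xR; rewrite memV xR !orbT. Qed.

Let K_notin x : x \in K -> (x \in H = false) * (x \in R = false).
Proof.
move=> xK; move: uKHR; rewrite cat_uniq => /and3P [_ /hasPn nK _].
by split; apply/negP => a; have := nK x; rewrite mem_cat a ?orbT /= xK => /(_ isT).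
Qed.

Let H_notin x : x \in H -> x \in R = false.
Proof.
move=> xH; move: uKHR; rewrite !cat_uniq => /and3P [_ _ /and3P [_ /hasPn nH _]].
by apply/negP => /nH; rewrite /= xH.
Qed.

Lemma strong_degree (g : nat -> nat -> nat) x :
  (forall x y z, x \in V -> y \in V -> z \in V -> madj M x y ->
     madj M x z -> g x y < c -> g x y = g x z -> y = z) ->
  x \in V -> \sum_(y <- V) (madj M x y && (g x y < c)) <= c.
Proof.
move=> gp xV; rewrite sum_nat_count -size_filter -[X in _ <= X](size_iota 0).
rewrite -(size_map (g x)); apply: uniq_leq_size.
  rewrite map_inj_in_uniq ?filter_uniq // => y z.
  rewrite !mem_filter => /andP [/andP [axy lt] yV] /andP [/andP [axz _] zV].
  exact: gp.
by move=> z /mapP [y]; rewrite mem_filter mem_iota => /andP [/andP [_ lt] _] ->.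
Qed.

Lemma sum_incE F : sumVV (fun x y => F x y : nat) =
  sumVV (fun x y => inc x y * F x y) + sumVV (fun x y => (~~ inc x y) * F x y).
Proof.
rewrite -big_split /=; apply: eq_bigr => x _; rewrite -big_split /=.
by apply: eq_bigr => y _; case: (inc x y); lia.
Qed.

(** A proper colouring has at most [c] strong edges at each vertex of [H], so at least
    [e - c * size H] of the edges meeting [H] are weak. None of these lies inside [K], so the
    restriction to [K] saves them all. *)
Lemma colorable_restrict e k :
  sumVV (fun x y => (inc x y * madj M x y)%N) = e.*2 ->
  colorable M V c k ->
  e - c * size H <= k /\ colorable M K c (k - (e - c * size H)).
Proof.
move=> Ee [g [gs gp gk]].
pose weak x y := madj M x y && (c <= g x y).
pose strong x y := madj M x y && (g x y < c).
have leK : \sum_(x <- K) \sum_(y <- K) weak x y <=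
           sumVV (fun x y => (~~ inc x y) * weak x y).
  rewrite -(sum_restrict _ uK V_uniq sKV); apply: leq_sum => x _.
  case xK: (x \in K); rewrite ?mul0n // mul1n.
  rewrite -(sum_restrict _ uK V_uniq sKV); apply: leq_sum => y _.
  case yK: (y \in K); rewrite ?mul0n // /inc.
  by rewrite (K_notin xK).1 (K_notin yK).1.
(* Ordered pairs are charged to their first and to their second component in [H], which gives [c]
   twice for each vertex of [H]. *)
have leI : sumVV (fun x y => inc x y * strong x y) <= (c * size H).*2.
  apply: (@leq_trans (\sum_(x <- V) (x \in H) * (\sum_(y <- V) strong x y) +
                      \sum_(y <- V) (y \in H) * (\sum_(x <- V) strong y x))).
    rewrite [X in _ + X](_ : _ = \sum_(x <- V) \sum_(y <- V) (y \in H) * strong y x).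
      2: by rewrite exchange_big /=; apply: eq_bigr => y _; rewrite muln_sumr.
    rewrite -big_split /= [X in X <= _]big_seq [X in _ <= X]big_seq.
    apply: leq_sum => x xV; rewrite muln_sumr /= -big_split /=.
    rewrite [X in X <= _]big_seq [X in _ <= X]big_seq.
    apply: leq_sum => y yV; rewrite /inc.
    have -> : strong y x = strong x y by rewrite /strong madj_sym gs.
    by case: (x \in H); case: (y \in H); case: (strong x y).
  rewrite !(sum_restrict _ uH V_uniq sHV) addnn leq_double -sum_const_seq.
  rewrite [X in X <= _]big_seq [X in _ <= X]big_seq; apply: leq_sum => x xH.
  by apply: strong_degree gp _; exact: sHV.
have Esplit : sumVV (fun x y => inc x y * weak x y) +
              sumVV (fun x y => inc x y * strong x y) = e.*2.
  rewrite -Ee -big_split /=; apply: eq_bigr => x _; rewrite -big_split /=.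
  apply: eq_bigr => y _; rewrite /weak /strong leqNgt.
  by case: (inc x y); case: (madj M x y); case: (g x y < c).
have := sum_incE weak; rewrite /weak in leK gk Esplit *; move=> Esum.
have gk' : sumVV (fun x y => madj M x y && (c <= g x y)) <= k.*2 by [].
move: gk'; rewrite Esum => gk'.
split; first by lia.
exists g; split.
- by move=> x y /sKV xV /sKV yV; exact: gs.
- by move=> x y z /sKV xV /sKV yV /sKV zV; exact: gp.
- by lia.
Qed.

Let pairs := [seq (v, j) | v <- H, j <- iota 0 c].
Let pendant (B : seq nat) (p : nat * nat) := blob (leaf p.1 p.2) == B.
Let pos x := index x (blob x).
(** Twice the position of the leaf plus this shift is [2 * c + j], which is [j] modulo [c]. In a
    blob without pendant edge the default pair is used, where any shift is as good. *)
Let shift (B : seq nat) :=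
  let p := nth (0, 0) pairs (find (pendant B) pairs) in
  p.2 + (c - pos (leaf p.1 p.2)).*2.

(* The colouring (i + j) mod c of the complete graph on c vertices misses the
   colour 2i at vertex i, which is thus free for a pendant edge; the shift makes
   it the one prescribed for that edge. *)
Let blob_color x y :=
  if blob x == blob y then (pos x + pos y + shift (blob x)) %% c else c.

Let pos_lt x : x \in R -> pos x < c.
Proof. by move=> xR; apply: leq_trans (blob_size xR); rewrite index_mem blob_mem. Qed.

Let pos_inj x y : x \in R -> y \in R -> blob x = blob y -> pos x = pos y -> x = y.
Proof.
move=> xR yR E; rewrite /pos -E => Ei.
rewrite -(nth_index 0 (blob_mem xR)) Ei nth_index // E.
exact: blob_mem.
Qed.

(** The diagonal value [blob_color x x] is the colour missing at [x] inside its blob, by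
    [blob_color_inj] and irreflexivity. It is therefore free for the pendant edge at [x]. *)
Let leaf_color v j : v \in H -> j < c ->
  blob_color (leaf v j) (leaf v j) = j.
Proof.
move=> vH ltj; rewrite /blob_color eqxx /shift.
set B := blob _; have hp : has (pendant B) pairs.
  apply/hasP; exists (v, j); last exact: eqxx.
  by apply/allpairsP; exists (v, j); rewrite mem_iota.
have := nth_find (0, 0) hp; have := mem_nth (0, 0) (s := pairs) _.
set p := nth _ _ _ => mp /eqP Ep.
have /allpairsP [[v' j'] /= [v'H]] : p \in pairs by apply: mp; rewrite -has_find.
rewrite mem_iota /= add0n => ltj' Epv; rewrite Epv /= in Ep *.
have [-> ->] := leaf_blob_inj v'H vH ltj' ltj Ep.
have lt := pos_lt (leafP vH ltj).1.
rewrite (_ : _ + _ = 2 * c + j); last by lia.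
by rewrite modnMDl modn_small.
Qed.

Let blob_color_inj x y z : x \in R -> y \in R -> z \in R ->
  blob y = blob x -> blob z = blob x -> blob_color x y = blob_color x z -> y = z.
Proof.
move=> xR yR zR Ey Ez; rewrite /blob_color Ey Ez eqxx => /eqP.
rewrite -!addnA eqn_modDl eqn_modDr.
rewrite !modn_small ?pos_lt // => /eqP; apply: pos_inj => //.
by rewrite Ey Ez.
Qed.

Let pendant_edge x v := has (fun j => x == leaf v j) (iota 0 c).

Let pendant_edgeP x v : v \in H -> pendant_edge x v ->
  exists j, [/\ j < c, x = leaf v j & blob_color x x = j].
Proof.
move=> vH /hasP [j]; rewrite mem_iota /= => ltj /eqP ->; exists j.
by split=> //; exact: leaf_color.
Qed.

(** All edges at [H] other than the pendant ones are made weak, since the pendant edges already use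
    all [c] colours at each vertex of [H]. *)
Let ext (g : nat -> nat -> nat) x y :=
  if x \in R then
    if y \in R then blob_color x y
    else if (y \in H) && pendant_edge x y then blob_color x x else c
  else if y \in R then
    if (x \in H) && pendant_edge y x then blob_color y y else c
  else if (x \in K) && (y \in K) then g x y else c.

Let ext_sym g : {in K &, forall x y, g x y = g y x} -> forall x y, ext g x y = ext g y x.
Proof.
move=> gs x y; rewrite /ext; case xR: (x \in R); case yR: (y \in R) => //.
  by rewrite /blob_color eq_sym; case: eqP => // ->; rewrite [pos x + _]addnC.
by rewrite andbC; case: ifP => // /andP [yK xK]; exact: gs.
Qed.

Let ext_proper g :
  (forall x y z, x \in K -> y \in K -> z \in K -> madj M x y ->
     madj M x z -> g x y < c -> g x y = g x z -> y = z) ->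
  forall x y z, x \in V -> y \in V -> z \in V -> madj M x y ->
     madj M x z -> ext g x y < c -> ext g x y = ext g x z -> y = z.
Proof.
move=> gp x y z xV yV zV axy axz.
have := xV; rewrite memV => /or3P [xK|xH|xR].
- have notR t : t \in V -> madj M x t -> t \in R = false.
    move=> tV axt; apply/negP => tR; have atx : madj M t x by rewrite madj_sym.
    by have [|[]] := R_closed tR xV atx; rewrite (K_notin xK).
  rewrite /ext !(K_notin xK) (notR y) // (notR z) // xK /=.
  case: ifP => [yK|]; last by rewrite ltnn.
  case: ifP => [zK|_ lt E]; last by rewrite E ltnn in lt.
  exact: gp.
- have xK : (x \in K) = false by apply/negP => /K_notin []; rewrite xH.
  rewrite /ext (H_notin xH) xH xK /=.
  case: ifP => yR; last by rewrite ltnn.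
  case: ifP => [/(pendant_edgeP xH) [j [ltj -> ->]]|_]; last by rewrite ltnn.
  case: ifP => zR lt; last by move=> E; rewrite E ltnn in lt.
  case: ifP => [/(pendant_edgeP xH) [j' [ltj' -> ->]] ->//|_ E].
  by rewrite E ltnn in lt.
- rewrite /ext xR.
  have [yH|[yR Ey]] := R_closed xR yV axy; have [zH|[zR Ez]] := R_closed xR zV axz.
  + rewrite (H_notin yH) yH (H_notin zH) zH /=.
    case: ifP => [/(pendant_edgeP yH) [j [ltj Ej _]]|]; last by rewrite ltnn.
    case: ifP => [/(pendant_edgeP zH) [j' [ltj' Ej' _]] _ _|_ lt E]; last first.
      by rewrite E ltnn in lt.
    (* Both pendant edges end at [x], thus in the same blob, and a blob serves only one pair
       [(v, j)]. *)
    have E : blob (leaf y j) = blob (leaf z j') by rewrite -Ej -Ej'.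
    by have [] := leaf_blob_inj yH zH ltj ltj' E.
  + rewrite (H_notin yH) yH zR /=; case: ifP => _ lt E; last by rewrite ltnn in lt.
    (* The pendant edge has the diagonal colour of [x], so an edge of this colour inside the blob
       would be a loop. The next case is symmetric. *)
    by have Exz := blob_color_inj xR xR zR erefl Ez E; rewrite -Exz madj_irr in axz.
  + rewrite yR (H_notin zH) zH /=; case: ifP => _ lt E; last by rewrite E ltnn in lt.
    by have Exy := blob_color_inj xR yR xR Ey erefl E; rewrite Exy madj_irr in axy.
  + rewrite yR zR => _ E; exact: blob_color_inj xR yR zR Ey Ez E.
Qed.

Lemma colorable_extend e k :
  sumVV (fun x y => (inc x y * madj M x y)%N) = e.*2 ->
  e - c * size H <= k -> colorable M K c (k - (e - c * size H)) ->
  colorable M V c k.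
Proof.
move=> Ee lek [g [gs gp gk]]; exists (ext g).
split; [by move=> x y _ _; exact: ext_sym | exact: ext_proper |].
pose weak x y := madj M x y && (c <= ext g x y).
pose strong x y := madj M x y && (ext g x y < c).
(* Away from [H], an edge lies inside [K] or inside a blob, and inside blobs every edge is
   strong. *)
have leK : sumVV (fun x y => (~~ inc x y) * weak x y) <=
           \sum_(x <- K) \sum_(y <- K) (madj M x y && (c <= g x y)).
  rewrite -(sum_restrict _ uK V_uniq sKV).
  rewrite [X in X <= _]big_seq [X in _ <= X]big_seq; apply: leq_sum => x xV.
  rewrite -(sum_restrict _ uK V_uniq sKV) muln_sumr.
  rewrite [X in X <= _]big_seq [X in _ <= X]big_seq; apply: leq_sum => y yV.
  rewrite /inc; case xH: (x \in H) => //; case yH: (y \in H) => //=.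
  rewrite mul1n; case axy: (weak x y) => //; move: axy => /andP [axy].
  have ayx : madj M y x by rewrite madj_sym.
  have := xV; have := yV; rewrite !memV xH yH /= /ext.
  case xR: (x \in R); case yR: (y \in R); rewrite ?orbT ?orbF => yK xK.
  - rewrite /blob_color; have [|[_ ->]] := R_closed xR yV axy; first by rewrite yH.
    by rewrite eqxx leqNgt ltn_pmod // (leq_ltn_trans _ (pos_lt xR)).
  - by have [|[]] := R_closed xR yV axy; rewrite ?yH ?yR.
  - by have [|[]] := R_closed yR xV ayx; rewrite ?xH ?xR.
  - by rewrite xK yK /= axy /= => ->.
(* The [c] pendant edges at each vertex of [H] are strong. They are counted once from [H] to [R] and
   once from [R] to [H], and these pairs do not overlap because [H] and [R] are disjoint. *)
have leI : (c * size H).*2 <= sumVV (fun x y => inc x y * strong x y).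
  have deg v : v \in H -> c <= \sum_(y <- R) strong v y.
    move=> vH; rewrite sum_nat_count -size_filter -[X in X <= _](size_iota 0).
    rewrite -(size_map (leaf v)); apply: uniq_leq_size.
      rewrite map_inj_in_uniq ?iota_uniq // => j j'; rewrite !mem_iota /= => lt lt' E.
      by have [] := leaf_blob_inj vH vH lt lt' (congr1 blob E).
    move=> u /mapP [j]; rewrite mem_iota /= => ltj ->.
    have [uR' au] := leafP vH ltj; rewrite mem_filter uR' andbT /strong au /=.
    rewrite /ext (H_notin vH) uR' vH /=.
    have -> : pendant_edge (leaf v j) v.
      by apply/hasP; exists j; rewrite ?mem_iota.
    by rewrite leaf_color.
  have deg2 : c * size H <=
      \sum_(x <- V) \sum_(y <- V) ((x \in H) && (y \in R)) * strong x y.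
    rewrite -sum_const_seq -(sum_restrict _ uH V_uniq sHV); apply: leq_sum => x _.
    case xH: (x \in H) => //; rewrite mul1n; apply: leq_trans (deg x xH) _.
    by rewrite -(sum_restrict _ uR V_uniq sRV).
  have deg3 : c * size H <=
      \sum_(x <- V) \sum_(y <- V) ((y \in H) && (x \in R)) * strong x y.
    rewrite exchange_big /=; apply: leq_trans deg2 _.
    apply: leq_sum => x _; apply: leq_sum => y _.
    have -> // : strong y x = strong x y by rewrite /strong madj_sym (ext_sym gs).
  rewrite -addnn; apply: leq_trans (leq_add deg2 deg3) _.
  rewrite -big_split /=; apply: leq_sum => x _; rewrite -big_split /=.
  apply: leq_sum => y _; rewrite /inc; case xH: (x \in H).
    rewrite (H_notin xH) andbF.
    by case: (y \in R); case: (strong x y).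
  by case: (y \in H); case: (x \in R); case: (strong x y).
have Esplit : sumVV (fun x y => inc x y * weak x y) +
              sumVV (fun x y => inc x y * strong x y) = e.*2.
  rewrite -Ee -big_split /=; apply: eq_bigr => x _; rewrite -big_split /=.
  apply: eq_bigr => y _; rewrite /weak /strong leqNgt.
  by case: (inc x y); case: (madj M x y); case: (ext g x y < c).
have Esum := sum_incE weak.
have -> : \sum_(x <- V) \sum_(y <- V) (madj M x y && (c <= ext g x y)) =
          sumVV (fun x y => weak x y : nat) by [].
by rewrite Esum; lia.
Qed.

End Reduction.

Lemma edge_count_double M H :
  (forall x y, madj M x y = madj M y x) -> (forall x, madj M x x = false) ->
  \sum_(x <- iota 0 (size M)) \sum_(y <- iota 0 (size M))
     ((x \in H) || (y \in H)) * madj M x y = (edge_count M H).*2.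
Proof.
move=> sym irr; pose r x y := madj M x y && ((x \in H) || (y \in H)).
transitivity (\sum_(x <- iota 0 (size M)) \sum_(y <- iota 0 (size M)) r x y).
  apply: eq_bigr => x _; apply: eq_bigr => y _; rewrite /r.
  by case: (_ || _); rewrite ?andbT ?andbF // mul1n.
rewrite (@sum_sym_rel _ _ id) => [|x y|x y]; first last.
- by rewrite /r; case: eqP => // ->; rewrite irr.
- by rewrite /r sym orbC.
congr _.*2; rewrite /edge_count size_flatten /shape -map_comp sumnE big_map.
by apply: eq_bigr => x _; rewrite /= sum_nat_count size_filter.
Qed.

Section MatrixReduction.

Variables (M : seq (seq bool)) (c : nat).
Hypothesis madj_sym : forall x y, madj M x y = madj M y x.
Hypothesis madj_irr : forall x, madj M x x = false.

(** [c] is the capped number used to compute the blobs, [c'] the true number of colours. If they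
    differ there are no heavy vertices, and only small connected components are deleted, which [c']
    colours suffice to colour. *)
Lemma colorable_kept (c' k : nat) : c <= c' -> (heavy M c = [::] \/ c' = c) ->
  colorable M (iota 0 (size M)) c' k <->
  weak_count M c <= k /\ colorable M (kept M c) c' (k - weak_count M c).
Proof.
move=> lecc' Hc.
pose R := flatten (removed M c).
pose blob x := nth [::] (removed M c) (find (fun B => x \in B) (removed M c)).
pose leaf v j := nth 0 (nth [::] (private M c v) j)
   (find (madj M v) (nth [::] (private M c v) j)).
have blobP B x : B \in removed M c -> x \in B -> blob x = B.
  move=> Br xB; have hB : has (fun B => x \in B) (removed M c) by apply/hasP; exists B.
  have xb : x \in blob x by exact: (nth_find [::] hB).
  have br : blob x \in removed M c by rewrite mem_nth // -has_find.
  have [b1 _] := smallsP _ _ _ (removed_small br).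
  have [b2 _] := smallsP _ _ _ (removed_small Br).
  exact: (blob_disjoint b1 b2 xb xB).
have RP x : x \in R -> x \in blob x /\ blob x \in removed M c.
  by move=> /flattenP [B Br xB]; rewrite (blobP B x).
have leaf_mem v j : v \in heavy M c -> j < c ->
    [/\ nth [::] (private M c v) j \in removed M c,
        leaf v j \in nth [::] (private M c v) j & madj M v (leaf v j)].
  move=> vH ltj; have Bp : nth [::] (private M c v) j \in private M c v.
    by rewrite mem_nth // size_private.
  have [Br [u uB au]] := privateP vH Bp.
  have hu : has (madj M v) (nth [::] (private M c v) j) by apply/hasP; exists u.
  split=> //; first by rewrite mem_nth // -has_find.
  exact: (nth_find 0 hu).
have heavy_c v j : v \in heavy M c -> j < c' -> j < c.
  by case: Hc => [-> //|<-].
have ltR : {in R, forall x, size (blob x) <= c'}.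
  move=> x /RP [_ br]; have [_ le] := smallsP _ _ _ (removed_small br).
  exact: leq_trans lecc'.
have cl x y : x \in R -> y \in iota 0 (size M) -> madj M x y ->
    y \in heavy M c \/ y \in R /\ blob y = blob x.
  move=> xR; rewrite mem_iota /= => lty axy; have [xb br] := RP _ xR.
  have [yB|] := removed_closed madj_sym br xb lty axy; last by left.
  right; split; last by rewrite (blobP (blob x)).
  by apply/flattenP; exists (blob x).
have lfP v j : v \in heavy M c -> j < c' -> leaf v j \in R /\ madj M v (leaf v j).
  move=> vH /(heavy_c _ _ vH) ltj; have [Br lB al] := leaf_mem _ _ vH ltj.
  by split=> //; apply/flattenP; exists (nth [::] (private M c v) j).
have lfI v v' j j' : v \in heavy M c -> v' \in heavy M c -> j < c' -> j' < c' ->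
    blob (leaf v j) = blob (leaf v' j') -> v = v' /\ j = j'.
  move=> vH vH' /(heavy_c _ _ vH) ltj /(heavy_c _ _ vH') ltj'.
  have [Br lB _] := leaf_mem _ _ vH ltj; have [Br' lB' _] := leaf_mem _ _ vH' ltj'.
  rewrite (blobP _ _ Br lB) (blobP _ _ Br' lB') => E.
  have Bp : nth [::] (private M c v) j \in private M c v.
    by rewrite mem_nth // size_private.
  have Bp' : nth [::] (private M c v) j \in private M c v'.
    by rewrite E mem_nth // size_private.
  have Ev := private_inj Bp Bp'; split=> //.
  apply/eqP; rewrite -(nth_uniq [::] _ _ (private_uniq M c v)) ?size_private //.
  by rewrite E Ev.
have part := vertex_partition M c; have uV := iota_uniq 0 (size M).
have Ee := edge_count_double (heavy M c) madj_sym madj_irr.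
have -> : weak_count M c = edge_count M (heavy M c) - c' * size (heavy M c).
  by rewrite /weak_count; case: Hc => [->|->]; rewrite ?muln0.
split=> [|[]].
  exact: (colorable_restrict madj_sym uV part Ee).
exact: (colorable_extend madj_sym madj_irr uV part
         (fun x xR => (RP x xR).1) ltR cl lfP lfI Ee).
Qed.

End MatrixReduction.

(** * The kernel *)

Definition graph_matrix (G : graph) : seq (seq bool) :=
  [seq [seq adj x y | y <- enum (vertex G)] | x <- enum (vertex G)].

Lemma size_graph_matrix G : size (graph_matrix G) = nverts G.
Proof. by rewrite size_map size_enum_ord. Qed.

Lemma madj_graph G (i j : vertex G) : madj (graph_matrix G) i j = adj i j.
Proof.
rewrite /madj (nth_map i) ?size_enum_ord ?ltn_ord //.
by rewrite (nth_map i) ?size_enum_ord ?ltn_ord // !nth_ord_enum.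
Qed.

Lemma madj_graph_ge G x y : nverts G <= x \/ nverts G <= y ->
  madj (graph_matrix G) x y = false.
Proof.
move=> H; rewrite /madj; have [lex|ltx] := leqP (nverts G) x.
  by rewrite [nth [::] _ _]nth_default ?nth_nil ?size_graph_matrix.
rewrite (nth_map (Ordinal ltx)) ?size_enum_ord //.
rewrite nth_default // size_map size_enum_ord; case: H => //; lia.
Qed.

Lemma madj_graphE G x y : madj (graph_matrix G) x y =
  if insub x is Some i then if insub y is Some j then @adj G i j else false
  else false.
Proof.
case: insubP => [i _ <-|]; last by rewrite -leqNgt => le; rewrite madj_graph_ge; auto.
case: insubP => [j _ <-|]; first exact: madj_graph.
by rewrite -leqNgt => le; rewrite madj_graph_ge; auto.
Qed.

Lemma madj_graph_sym G x y : madj (graph_matrix G) x y = madj (graph_matrix G) y x.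
Proof.
rewrite !madj_graphE; case: (insub x) => [i|]; case: (insub y) => [j|] //.
exact: adj_sym.
Qed.

Lemma madj_graph_irr G x : madj (graph_matrix G) x x = false.
Proof. by rewrite madj_graphE; case: (insub x) => [i|] //; exact: adj_irr. Qed.

Definition induced_graph (G : graph) (s : seq nat) : graph :=
  @Graph (size s)
    (fun i j : 'I_(size s) => madj (graph_matrix G) (nth 0 s i) (nth 0 s j))
    (fun i j => madj_graph_sym G _ _) (fun i => madj_graph_irr G _).

Lemma map_nth_enum (T : Type) (f : nat -> T) (s : seq nat) :
  [seq f (nth 0 s i) | i : 'I_(size s) <- enum 'I_(size s)] = map f s.
Proof.
rewrite -[in RHS](mkseq_nth 0 s) /mkseq -map_comp -val_enum_ord -map_comp.
exact: eq_map.
Qed.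

Lemma induced_matrix G s :
  graph_matrix (induced_graph G s) = submatrix (graph_matrix G) s.
Proof.
rewrite /graph_matrix /submatrix /=.
rewrite -(map_nth_enum (fun x => [seq madj (graph_matrix G) x y | y <- s]) s).
by apply: eq_map => i /=; rewrite map_nth_enum.
Qed.

Definition K2_rel : rel 'I_2 := fun i j => i != j.

Lemma K2_sym : symmetric K2_rel. Proof. by move=> i j; rewrite /K2_rel eq_sym. Qed.

Lemma K2_irr : irreflexive K2_rel. Proof. by move=> i; rewrite /K2_rel eqxx. Qed.

Definition K2 : graph := Graph K2_sym K2_irr.

Lemma K2_matrix : graph_matrix K2 = [:: [:: false; true]; [:: true; false]].
Proof.
rewrite /graph_matrix /vertex /= !enum_ordSl /= enum_ord0 /=.
by [].
Qed.

Lemma no_ECS_K2 : ~ ECS (ECSInstance K2 0 0).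
Proof.
move=> [S [W [[_ _ EW] _]]] /=; rewrite leqn0 cards_eq0 => /eqP W0.
have : [set: 'I_2] \in edges K2.
  rewrite inE; apply/existsP; exists ord0; apply/existsP; exists ord_max.
  rewrite /= /K2_rel /=; apply/eqP/setP => i; rewrite !inE.
  by case: i => [[|[|]]].
by rewrite -EW W0 setU0 => /bigcupP [[]].
Qed.

Definition kernel (I : ecs_instance) : ecs_instance :=
  let M := graph_matrix (ecs_graph I) in
  let c := minn (size M) (ecs_colors I) in
  if weak_count M c <= ecs_budget I
  then ECSInstance (induced_graph (ecs_graph I) (kept M c)) (ecs_colors I)
         (ecs_budget I - weak_count M c)
  else ECSInstance K2 0 0.

Definition instance_code (I : ecs_instance) :=
  (graph_matrix (ecs_graph I), (bits (ecs_colors I), bits (ecs_budget I))).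

Lemma encode_instance I : enc_instance I = encode (instance_code I).
Proof.
rewrite /enc_instance /encode /encodable_prod /=; congr Node.
rewrite /enc_graph /encodable_seq /graph_matrix -map_comp; congr enc_seq.
by apply: eq_map => x /=; rewrite -map_comp.
Qed.

Lemma kernel_codeE I : kernel_code (instance_code I) = instance_code (kernel I).
Proof.
rewrite /kernel_code /kernel /=; set M := graph_matrix _.
rewrite !cap_bits; set w := weak_count _ _.
have -> : (minn w (ecs_budget I) == w) = (w <= ecs_budget I).
  by apply/eqP/minn_idPl.
case: ifP => _; rewrite /instance_code /=.
  by rewrite induced_matrix iter_bpred_bits.
by rewrite K2_matrix.
Qed.

Lemma kernel_polytime : polytime_computable kernel.
Proof.
have [p [P [Pb H]]] := polytime_kernel_code.
have [a [d leP]] := polybound_monomial Pb.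
exists p, a, d => I bound.
have s0 : input_store (enc_instance I) 0 = encode (instance_code I).
  by rewrite -encode_instance.
have [t [s [e o _ let_ lesz]]] := H _ _ s0.
have le := leP _ (tree_size_gt0 (enc_instance I)).
have Esz : tsz (instance_code I) = tree_size (enc_instance I).
  by rewrite tsz.unlock -encode_instance.
exists t, s; split=> //.
- by rewrite o kernel_codeE encode_instance.
- by rewrite (leq_trans let_) // Esz.
- rewrite o; apply: leq_trans (leq_trans lesz _); last by rewrite Esz.
  by rewrite tsz.unlock.
Qed.

(** * Big blobs and component covers *)

Section ComponentCover.

Variables (G : graph) (c : nat) (D : {set vertex G}).
Hypothesis D_cover : component_cover c D.
Notation M := (graph_matrix G).

Lemma grown_connect (s : seq (vertex G)) :
  grown M (map val s) -> {in s, forall i, i \notin D} ->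
  {in s &, forall i j, connect (adj_minus D) i j}.
Proof.
have csym : connect_sym (adj_minus D).
  by apply: sym_connect_sym => i j; rewrite /adj_minus /= adj_sym andbCA.
elim: s => //= y s IH /andP [/orP hy gs] nD.
have {}IH := IH gs (fun i is_ => nD i (mem_behead (s := y :: s) is_)).
have base j : j \in s -> connect (adj_minus D) y j.
  move=> js; case: hy => [|/hasP [_ /mapP [z zs ->] ayz]].
    by case: (s) js.
  apply: connect_trans (IH _ _ zs js); apply: connect1.
  by rewrite /adj_minus /= !nD ?mem_head ?inE ?zs ?orbT // -madj_graph.
move=> i j; rewrite !inE => /orP [/eqP ->|is_] /orP [/eqP ->|js].
- exact: connect0.
- exact: base.
- by rewrite csym; exact: base.
- exact: IH.
Qed.

(** Otherwise the blob, being connected, would lie in one component of the graph without [D] and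
    give it more than [c] vertices. *)
Lemma big_blob_meets B : B \in blobs M c -> c < size B ->
  has (mem (map val (enum D))) B.
Proof.
move=> BB ltB; apply: contraT => /hasPn nB.
have [s Es] : exists s : seq (vertex G), B = map val s.
  have : all (fun x => x < nverts G) B.
    apply/allP => x xB; rewrite -size_graph_matrix -(mem_flatten_blobs _ c).
    by apply/flattenP; exists B.
  elim: (B) => [|x r IH] /=; first by exists [::].
  by move=> /andP [ltx /IH [s ->]]; exists (Ordinal ltx :: s).
have nD : {in s, forall i, i \notin D}.
  move=> i is_; have iB : val i \in B by rewrite Es map_f.
  have : val i \notin map val (enum D) := nB _ iB.
  by rewrite (mem_map val_inj) mem_enum.
have [_ _ gB] := blobP BB; rewrite Es in gB.
have us : uniq s by rewrite -(map_inj_uniq val_inj) -Es (blob_uniq BB).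
case: s Es nD gB us => [|x s] Es nD gB us; first by rewrite Es in ltB.
have conn := grown_connect gB nD.
pose K := [set y in ~: D | connect (adj_minus D) x y].
have KP : K \in components_minus D.
  by apply: imset_f; rewrite inE nD ?mem_head.
have := forall_inP D_cover K KP; rewrite leqNgt => /negP [].
apply: leq_trans ltB _; rewrite Es size_map -(card_uniqP us).
apply: subset_leq_card; apply/subsetP => y ys.
by rewrite !inE nD // conn ?mem_head.
Qed.

Lemma size_bigs_cover : size (bigs M c) <= c.+1 * #|D|.
Proof.
rewrite size_bigs mulnC leq_mul2l /= cardE -size_filter.
pose E := map val (enum D); pose Bs := [seq B <- blobs M c | c < size B].
(* A vertex of [D] in each big blob; these representatives are distinct because the blobs are
   disjoint. *)
pose h (B : seq nat) := nth 0 B (find (mem E) B).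
have hP B : B \in Bs -> h B \in B /\ h B \in E.
  rewrite mem_filter => /andP [ltB BB]; have hB := big_blob_meets BB ltB.
  by rewrite mem_nth -?has_find //; split=> //; exact: (nth_find 0 hB).
have uBs : uniq (map h Bs).
  rewrite map_inj_in_uniq ?filter_uniq ?blob_flatten_uniq_list // => A B As Bs' E'.
  have [hA _] := hP A As; have [hB _] := hP B Bs'; rewrite E' in hA.
  move: As Bs'; rewrite !mem_filter => /andP [_ AB] /andP [_ BB].
  exact: blob_disjoint AB BB hA hB.
rewrite -(size_map h) -(size_map val (enum D)); apply: uniq_leq_size uBs _.
by move=> x /mapP [B /hP [_ hE] ->].
Qed.

End ComponentCover.

Lemma size_bigs_conn (G : graph) (c : nat) :
  size (bigs (graph_matrix G) c) <= c.+1 * comp_order_conn G c.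
Proof.
rewrite /comp_order_conn; case: arg_minnP => [|D D_cover _].
  exact: component_cover_setT.
exact: size_bigs_cover.
Qed.

(** A big blob has more vertices than the minimum but at most [size M], so the minimum is not
    [size M]. Hence capping changes the parameter only when there are no big vertices. *)
Lemma bigs_cap (M : seq (seq bool)) (c : nat) :
  bigs M (minn (size M) c) != [::] -> minn (size M) c = c.
Proof.
case E: (bigs _ _) => [|v s] // _.
have : v \in bigs M (minn (size M) c) by rewrite E mem_head.
rewrite mem_bigs => /hasP [B BB /andP [ltB _]].
have : size B <= size M.
  rewrite -(size_iota 0 (size M)); apply: uniq_leq_size (blob_uniq BB) _.
  move=> x xB; rewrite mem_iota /= -(mem_flatten_blobs _ (minn (size M) c)).
  by apply/flattenP; exists B.
by move: ltB; lia.
Qed.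

(** For [c = 0] there are no slots, so no vertex is kept; this agrees with the vanishing factor
    [c ^ 3] in the size bound. *)
Lemma kept0 (M : seq (seq bool)) : kept M 0 = [::].
Proof.
have S0 : auction M 0 = [::] by apply: size0nil; rewrite size_auction.
by rewrite /kept S0 /=; apply: size0nil; rewrite cats0; elim: (bigs M 0).
Qed.

Lemma weak_count_heavy (G : graph) (c : nat) :
  heavy (graph_matrix G) c = [::] -> weak_count (graph_matrix G) c = 0.
Proof.
move=> H0; apply/eqP; rewrite -leqn0 /weak_count H0 muln0 subn0 -leq_double.
rewrite -edge_count_double; [|exact: madj_graph_sym|exact: madj_graph_irr].
by rewrite big1 // => x _; rewrite big1.
Qed.

(* For c = 0 and an instance with more than k edges, the factor c ^ 3 vanishes
   while the output must be a no-instance and so have a nonempty graph; the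
   summand (c == 0) only adds a constant in that degenerate case. *)
Theorem theorem2 :
  exists (C : nat) (kernel : ecs_instance -> ecs_instance),
    polytime_computable kernel /\
    forall (G : graph) (c k : nat),
      (ECS (kernel (ECSInstance G c k)) <-> ECS (ECSInstance G c k)) /\
      nverts (ecs_graph (kernel (ECSInstance G c k)))
        <= C * (c ^ 3 * comp_order_conn G c + (c == 0)).
Proof.
(* For positive [c], the product of [1 + c * c] and [c.+1] has four terms, each at most [c ^ 3]. *)
exists 4, kernel; split; first exact: kernel_polytime.
move=> G c k; rewrite /kernel /=.
set M := graph_matrix G; set m := minn (size M) c.
have heavy_bigs : heavy M m != [::] -> bigs M m != [::].
  by apply: contraNneq => E; rewrite /heavy E.
have Hm : heavy M m = [::] \/ c = m.
  have [->|/heavy_bigs b0] := eqVneq (heavy M m) [::]; first by left.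
  by right; rewrite /m (bigs_cap b0).
have red := colorable_kept (@madj_graph_sym G) (@madj_graph_irr G) k (geq_minr _ _) Hm.
have GE : ECS (ECSInstance G c k) <-> colorable M (iota 0 (size M)) c k.
  apply: ECS_colorable; first exact: iota_uniq.
    by rewrite size_iota size_graph_matrix.
  by move=> i j; rewrite !nth_iota ?size_graph_matrix ?ltn_ord // madj_graph.
split.
  rewrite GE; apply: iff_trans _ (iff_sym red); case: leqP => [lew|ltw].
    have KE := @ECS_colorable M (kept M m) (induced_graph G (kept M m)) c
      (k - weak_count M m) (kept_uniq _ _) erefl (fun i j => erefl).
    by rewrite KE; split=> [|[]].
  by split=> [/no_ECS_K2|[]].
have szb (b0 : bigs M m != [::]) : size (bigs M c) <= c.+1 * comp_order_conn G c.
  exact: size_bigs_conn.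
case: (leqP (weak_count M m) k) => [_|ltw] /=.
  have [b0|b0] := eqVneq (bigs M m) [::].
    by apply: leq_trans (size_kept M m) _; rewrite b0 muln0.
  rewrite /m (bigs_cap b0); case: (posnP c) => [->|c0]; first by rewrite kept0.
  apply: leq_trans (size_kept _ _) _; apply: leq_trans (leq_mul (leqnn _) (szb b0)) _.
  rewrite mulnA; apply: (@leq_trans (4 * c ^ 3 * comp_order_conn G c)).
    by rewrite leq_mul // !expnS expn0; nia.
  by rewrite -mulnA leq_mul ?leq_addr.
(* The output is now the single edge, with two vertices. A weak count above [k] is positive, so
   there are heavy, hence big, vertices, and [comp_order_conn G c] is positive when [c] is. *)
have b0 : bigs M m != [::].
  by apply: heavy_bigs; apply: contraTneq ltw => /weak_count_heavy ->.
case: (posnP c) => [->|c0]; first by rewrite addn1; lia.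
have b1 : 0 < size (bigs M c).
  by have := b0; rewrite /m (bigs_cap b0) -size_eq0 -lt0n.
have := leq_trans b1 (szb b0); rewrite muln_gt0 /= => l0.
have : 0 < c ^ 3 * comp_order_conn G c by rewrite muln_gt0 expn_gt0 c0.
lia.
Qed.
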